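(* Let $P$ be a process, $c$ a channel name, $\eta$ a session type, $\Gamma$ an environment mapping variables to types, and $\Delta$ a session environment. If $\Gamma \vdash P : \Delta \cup \{c : \eta\}$, $\eta$ is complete, and $P \downarrow c$ ($P$ is ready on $c$), then either $c \notin \mathrm{fn}(P)$ or $P \xrightarrow{\tau}$, i.e. there is a process $Q$ with $P\xrightarrow{\tau}Q$.
   Context: **Types.** Fix a set $\mathcal{V}$ of basic values. Types $t$ are: the empty type $\mathbb{0}$ (inhabited by no value), a singleton type $\mathsf{v}$ for each $\mathsf{v}\in\mathcal{V}$ (inhabited exactly by $\mathsf{v}$), and basic types $\mathtt{B}$ (from an unspecified collection of subsets of $\mathcal{V}$). Write $\mathsf{v}:t$ when $\mathsf{v}$ inhabits $t$. **Session types.** Session types $\eta,\theta,\rho,\dots$ are the possibly infinite syntax trees generated by $$\eta ::= \mathbf{0} \mid \mathbf{1} \mid \alpha.\eta \mid \eta+\eta \mid \eta\oplus\eta \mid \eta \mathbin{|} \eta, \qquad \alpha ::= {?t} \mid {!t} \mid {?\eta} \mid {!\eta}$$ such that (i) the tree has finitely many different subtrees; (ii) every infinite branch contains infinitely many occurrences of action prefix; (iii) the tree contains finitely many occurrences of $|$. **Transitions of session types.** Labels are $\mu ::= \checkmark \mid {?\mathsf{v}} \mid {!\mathsf{v}} \mid {?\rho} \mid {!\rho}$. The labeled relation $\xrightarrow{\mu}$ and the unlabeled (internal) relation $\to$ are inductively generated by these rules, plus the symmetric versions of those for $\oplus$, $+$ and $|$: - $\mathbf{1}\xrightarrow{\checkmark}\mathbf{1}$;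 $\ \eta\oplus\theta\to\eta$; $\ !\mathsf{v}.\eta\xrightarrow{!\mathsf{v}}\eta$; $\ !\rho.\eta\xrightarrow{!\rho}\eta$; $\ ?\rho.\eta\xrightarrow{?\rho}\eta$; - if $\mathsf{v}:t$ then $!t.\eta\to{!\mathsf{v}}.\eta$ and $?t.\eta\xrightarrow{?\mathsf{v}}\eta$; - if $\eta\to\eta'$ then $\eta+\theta\to\eta'+\theta$ and $\eta\mathbin{|}\theta\to\eta'\mathbin{|}\theta$; - if $\eta\xrightarrow{\mu}\eta'$ then $\eta+\theta\xrightarrow{\mu}\eta'$, and, if moreover $\mu\neq\checkmark$, $\eta\mathbin{|}\theta\xrightarrow{\mu}\eta'\mathbin{|}\theta$; - if $\eta\xrightarrow{\checkmark}\eta'$ and $\theta\xrightarrow{\checkmark}\theta'$ then $\eta\mathbin{|}\theta\xrightarrow{\checkmark}\eta'\mathbin{|}\theta'$; - if $\eta\xrightarrow{!\mathsf{v}}\eta'$ and $\theta\xrightarrow{?\mathsf{v}}\theta'$ then $\eta\mathbin{|}\theta\to\eta'\mathbin{|}\theta'$; - if $\eta\xrightarrow{!\rho}\eta'$ and $\theta\xrightarrow{?\rho'}\theta'$, then $\eta\mathbin{|}\theta\to\eta'\mathbin{|}\theta'$ when $\rho\preceq\rho'$, and $\eta\mathbin{|}\theta\to\mathbf{0}$ when $\rho\not\preceq\rho'$. $\Rightarrow$ is the reflexive transitive closure of $\to$, and $\eta\xRightarrow{\mu}$ means $\eta\Rightarrow\eta'\xrightarrow{\mu}\eta''$ for some $\eta',\eta''$.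 $\eta$ is *complete* if $\eta\Rightarrow\eta'$ implies $\eta'\xRightarrow{\checkmark}$. $\eta\preceq\theta$ if, for every session type $\rho$, $\eta\mathbin{|}\rho$ complete implies $\theta\mathbin{|}\rho$ complete. $\eta\sqsubseteq\theta$ if $\eta+\rho\preceq\theta+\rho$ for every $\rho$. The transition relation and $\preceq$ refer to each other; the circularity is broken by stratification: a session type has weight $0$ if it contains no prefix $?\rho$ or $!\rho$ with $\rho$ a session type, and weight $n>0$ if every session type $\rho$ in a prefix $?\rho$ or $!\rho$ occurring in it has weight at most $n-1$. The relations are to be understood as jointly satisfying the definitions above. **Processes.** $a,b,c,d$ range over channel names, $x,y,z$ over variables, $u,v$ over channel names and variables, $e$ over an unspecified language of expressions over basic values and variables ($e\downarrow\mathsf{v}$ means $e$ evaluates to $\mathsf{v}$). $$P ::= \mathtt{0} \mid \pi.P \mid {\star}P \mid P+P \mid P\oplus P \mid P\mathbin{|}P \mid (\nu c)P, \qquad \pi ::= u?(x:t) \mid u!e \mid u?(x) \mid u!v$$ (value input, value output, channel input, delegation, i.e. channel output). $\mathrm{subj}(\pi)=u$ is the subject of $\pi$. Input prefixes bind $x$; $(\nu c)$ binds $c$. $\mathrm{fn}(P)$ is the set of free channel names of $P$; $P\{m/x\}$ is substitution. **Transitions of processes.** Labels: $\ell ::= \tau \mid c?m \mid c!m \mid c!(d)$, where messages $m$ are basic values or channel names; $\mathrm{fn}(c?d)=\mathrm{fn}(c!d)=\{c,d\}$, $\mathrm{fn}(c?\mathsf{v})=\mathrm{fn}(c!\mathsf{v})=\mathrm{fn}(c!(d))=\{c\}$,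 $\mathrm{bn}(c!(d))=\{d\}$, other sets empty. The rules (with the symmetric versions for $\oplus,+,|$) are: - $P\oplus Q\xrightarrow{\tau}P$; $\ {\star}P\xrightarrow{\tau}{\star}P\mathbin{|}P$; $\ c?(x).P\xrightarrow{c?d}P\{d/x\}$; $\ c!d.P\xrightarrow{c!d}P$; - $c?(x:t).P\xrightarrow{c?\mathsf{v}}P\{\mathsf{v}/x\}$ if $\mathsf{v}:t$; $\ c!e.P\xrightarrow{c!\mathsf{v}}P$ if $e\downarrow\mathsf{v}$; - if $P\xrightarrow{\tau}P'$ then $P+Q\xrightarrow{\tau}P'+Q$; if $P\xrightarrow{\ell}P'$ with $\ell\neq\tau$ then $P+Q\xrightarrow{\ell}P'$; - if $P\xrightarrow{c!m}P'$ and $Q\xrightarrow{c?m}Q'$ then $P\mathbin{|}Q\xrightarrow{\tau}P'\mathbin{|}Q'$; - if $P\xrightarrow{c!(d)}P'$, $Q\xrightarrow{c?d}Q'$ and $d\notin\mathrm{fn}(Q)$ then $P\mathbin{|}Q\xrightarrow{\tau}(\nu d)(P'\mathbin{|}Q')$; - if $P\xrightarrow{\ell}P'$ and $\mathrm{bn}(\ell)\cap\mathrm{fn}(Q)=\emptyset$ then $P\mathbin{|}Q\xrightarrow{\ell}P'\mathbin{|}Q$; - if $P\xrightarrow{\ell}P'$ and $d\notin\mathrm{fn}(\ell)\cup\mathrm{bn}(\ell)$ then $(\nu d)P\xrightarrow{\ell}(\nu d)P'$; - if $P\xrightarrow{c!d}P'$ and $c\neq d$ then $(\nu d)P\xrightarrow{c!(d)}P'$.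 **Typing.** In $\Gamma\vdash P:\Delta$, $\Gamma$ maps variables to types $t$ and $\Delta$ (a session environment) maps channel names and channel variables to session types; $\mathrm{dom}(\Delta)$ is its domain. $\Gamma\vdash e:t$ is an unspecified judgment denoting that $e$ has type $t$ in $\Gamma$; it is understood to be stable under replacing variables by values of their declared types, and sound: a well-typed closed expression of type $t$ evaluates, and only to values of type $t$. The rules are: - (weak) if $\Gamma\vdash P:\Delta$ and $u\notin\mathrm{dom}(\Delta)$ then $\Gamma\vdash P:\Delta\cup\{u:\mathbf{1}\}$; - (sub) if $\Gamma\vdash P:\Delta\cup\{u:\theta\}$ and $\eta\sqsubseteq\theta$ then $\Gamma\vdash P:\Delta\cup\{u:\eta\}$; - (res) if $\Gamma\vdash P:\Delta\cup\{c:\mathbf{1}+\eta\}$ then $\Gamma\vdash(\nu c)P:\Delta$; - (nil) $\Gamma\vdash\mathtt{0}:\emptyset$; - (input) if $\Gamma,x:t\vdash P:\Delta\cup\{u:\eta\}$ then $\Gamma\vdash u?(x:t).P:\Delta\cup\{u:{?t}.\eta\}$; - (inputS) if $\Gamma\vdash P:\{x:\rho\}$ then $\Gamma\vdash u?(x).P:\{u:{?\rho}.\mathbf{1}\}$; - (output) if $\Gamma\vdash e:t$ and $\Gamma\vdash P:\Delta\cup\{u:\eta\}$ then $\Gamma\vdash u!e.P:\Delta\cup\{u:{!t}.\eta\}$; - (outputS) if $\Gamma\vdash P:\Delta\cup\{u:\eta,v:\theta\}$ then $\Gamma\vdash u!v.P:\Delta\cup\{u:{!\rho}.\eta,\ v:\theta\mathbin{|}\rho\}$;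 - (ext) if $\Gamma\vdash\pi_i.P_i:\Delta\cup\{u:\eta_i\}$ and $\mathrm{subj}(\pi_i)=u$ for all $i\in I$ ($I=\{1,\dots,n\}$) then $\Gamma\vdash\sum_{i\in I}\pi_i.P_i:\Delta\cup\{u:\sum_{i\in I}\eta_i\}$; - (int) if $\Gamma\vdash P:\Delta$ and $\Gamma\vdash Q:\Delta$ then $\Gamma\vdash P\oplus Q:\Delta$; - (bang) if $\Gamma\vdash P:\{u_i:\eta_i\}_{i\in I}$ and $\eta_i\sqsubseteq\eta_i\mathbin{|}\eta_i$ for all $i\in I$ then $\Gamma\vdash{\star}P:\{u_i:\eta_i\}_{i\in I}$; - (par) if $\Gamma\vdash P:\{u_i:\eta_i\}_{i\in I}$ and $\Gamma\vdash Q:\{u_i:\theta_i\}_{i\in I}$ then $\Gamma\vdash P\mathbin{|}Q:\{u_i:\eta_i\mathbin{|}\theta_i\}_{i\in I}$. Sums denote iterated external choice; unions $\Delta\cup\{\dots\}$ are of environments with disjoint domains. **Readiness.** $P\downarrow c$ (''$P$ is ready on $c$'') is inductively defined by: $\pi.P\downarrow\mathrm{subj}(\pi)$; $P\downarrow c$ if $c\notin\mathrm{fn}(P)$; if $P\downarrow c$ and $Q\downarrow c$ then $P+Q\downarrow c$ and $P\mathbin{|}Q\downarrow c$; if $P\downarrow c$ and $c\neq d$ then $(\nu d)P\downarrow c$.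
   Formalization: P is assumed to have no free variables (else c!y.0 | c?(x).0 with y a free channel variable is a counterexample), and every session type is assumed to have a finite weight (else transitions and ⪯ have no joint solution). *)

(* Defs.v *)
From mathcomp Require Import all_boot.
From Stdlib Require List.
From Stdlib Require Import Relation_Operators.

Set Implicit Arguments.
Unset Strict Implicit.
Unset Printing Implicit Defensive.

(* Channel names and variables are two disjoint countable sets; a [chan] is
   what [u], [v] range over in processes. *)
Notation name := nat.
Notation var := nat.
Notation chan := (name + var)%type.
Notation Name c := (@inl nat nat c).
Notation Var x := (@inr nat nat x).

Definition emptyenv (K V : Type) : K -> option V := fun _ => None.

Definition upd (K : eqType) (V : Type) (E : K -> option V) (k : K) (a : V) :
    K -> option V :=
  fun k' => if k' == k then Some a else E k'.

(** * Types *)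

Record values := Values {
  bval : Type;
  basic : Type;
  basic_mem : basic -> bval -> Prop }.

Inductive vtype (S : values) : Type :=
| TEmpty
| TSing (v : bval S)
| TBasic (B : basic S).
Arguments TEmpty {S}.

Definition inhab (S : values) (v : bval S) (t : vtype S) : Prop :=
  match t with
  | TEmpty => False
  | TSing w => v = w
  | TBasic B => basic_mem B v
  end.

(** * Session types *)

CoInductive stree (S : values) : Type :=
| SZero
| SOne
| SInV (t : vtype S) (k : stree S)
| SOutV (t : vtype S) (k : stree S)
| SInS (r : stree S) (k : stree S)
| SOutS (r : stree S) (k : stree S)
| SExt (a b : stree S)
| SInt (a b : stree S)
| SPar (a b : stree S).
Arguments SZero {S}.
Arguments SOne {S}.

(* Equality of infinite trees. *)
CoInductive bisim (S : values) : stree S -> stree S -> Prop :=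
| B_zero : bisim SZero SZero
| B_one : bisim SOne SOne
| B_inV t k k' : bisim k k' -> bisim (SInV t k) (SInV t k')
| B_outV t k k' : bisim k k' -> bisim (SOutV t k) (SOutV t k')
| B_inS r r' k k' :
    bisim r r' -> bisim k k' -> bisim (SInS r k) (SInS r' k')
| B_outS r r' k k' :
    bisim r r' -> bisim k k' -> bisim (SOutS r k) (SOutS r' k')
| B_ext a a' b b' : bisim a a' -> bisim b b' -> bisim (SExt a b) (SExt a' b')
| B_int a a' b b' : bisim a a' -> bisim b b' -> bisim (SInt a b) (SInt a' b')
| B_par a a' b b' : bisim a a' -> bisim b b' -> bisim (SPar a b) (SPar a' b').

Definition is_prefix (S : values) (T : stree S) : bool :=
  match T with
  | SInV _ _ | SOutV _ _ | SInS _ _ | SOutS _ _ => true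
  | _ => false
  end.

Definition message (S : values) (T : stree S) : option (stree S) :=
  match T with
  | SInS r _ | SOutS r _ => Some r
  | _ => None
  end.

(* In a prefix, [true] leads to the continuation and [false] to the session
   type that is communicated, if there is one. *)
Definition child (S : values) (d : bool) (T : stree S) : option (stree S) :=
  match T with
  | SZero | SOne => None
  | SInV _ k | SOutV _ k => if d then Some k else None
  | SInS r k | SOutS r k => Some (if d then k else r)
  | SExt a b | SInt a b | SPar a b => Some (if d then b else a)
  end.

Fixpoint subtree_at (S : values) (p : seq bool) (T : stree S) :
    option (stree S) :=
  match p with
  | [::] => Some T
  | d :: p' => if child d T is Some T' then subtree_at p' T' else None
  end.

Definition regular (S : values) (T : stree S) : Prop :=
  exists l : list (stree S), forall p s, subtree_at p T = Some s ->
    exists s', List.In s' l /\ bisim s s'.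

Definition contractive (S : values) (T : stree S) : Prop :=
  forall f : nat -> stree S,
    f 0 = T -> (forall n, exists d, child d (f n) = Some (f n.+1)) ->
    forall n, exists m, n <= m /\ is_prefix (f m).

Definition finitely_par (S : values) (T : stree S) : Prop :=
  exists l : seq (seq bool), forall p a b,
    subtree_at p T = Some (SPar a b) -> p \in l.

Fixpoint has_weight (S : values) (n : nat) (T : stree S) : Prop :=
  forall p s r, subtree_at p T = Some s -> message s = Some r ->
    match n with
    | 0 => False
    | m.+1 => has_weight m r
    end.

(* Stratification only makes sense for trees that have a weight, so having one
   is part of being a session type.  Over all regular trees the mutual
   definition of the transitions and of the preorder has no solution at all: the
   tree X = !X.1 + !1.1 (which has no weight) would have a partner with which
   it is complete iff it has none. *)
Definition session_type (S : values) (T : stree S) : Prop :=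
  [/\ regular T, contractive T, finitely_par T & exists n, has_weight n T].

Inductive slabel (S : values) : Type :=
| Tick
| SLInV (v : bval S)
| SLOutV (v : bval S)
| SLInS (r : stree S)
| SLOutS (r : stree S).
Arguments Tick {S}.

(* Labelled transitions do not depend on the preorder; internal ones do. *)
Inductive strans (S : values) : stree S -> slabel S -> stree S -> Prop :=
| ST_one : strans SOne Tick SOne
| ST_outV v k : strans (SOutV (TSing v) k) (SLOutV v) k
| ST_outS r k : strans (SOutS r k) (SLOutS r) k
| ST_inS r k : strans (SInS r k) (SLInS r) k
| ST_inV v t k : inhab v t -> strans (SInV t k) (SLInV v) k
| ST_extl a b m a' : strans a m a' -> strans (SExt a b) m a'
| ST_extr a b m b' : strans b m b' -> strans (SExt a b) m b'
| ST_parl a b m a' :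
    m <> Tick -> strans a m a' -> strans (SPar a b) m (SPar a' b)
| ST_parr a b m b' :
    m <> Tick -> strans b m b' -> strans (SPar a b) m (SPar a b')
| ST_partick a b a' b' :
    strans a Tick a' -> strans b Tick b' ->
    strans (SPar a b) Tick (SPar a' b').

(* [le] stands for the relation that compares communicated session types. *)
Inductive sint (S : values) (le : stree S -> stree S -> Prop) :
    stree S -> stree S -> Prop :=
| SI_intl a b : sint le (SInt a b) a
| SI_intr a b : sint le (SInt a b) b
| SI_outV v t k :
    inhab v t -> sint le (SOutV t k) (SOutV (TSing v) k)
| SI_extl a b a' : sint le a a' -> sint le (SExt a b) (SExt a' b)
| SI_extr a b b' : sint le b b' -> sint le (SExt a b) (SExt a b')
| SI_parl a b a' : sint le a a' -> sint le (SPar a b) (SPar a' b)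
| SI_parr a b b' : sint le b b' -> sint le (SPar a b) (SPar a b')
| SI_comVl a b v a' b' :
    strans a (SLOutV v) a' -> strans b (SLInV v) b' ->
    sint le (SPar a b) (SPar a' b')
| SI_comVr a b v a' b' :
    strans a (SLInV v) a' -> strans b (SLOutV v) b' ->
    sint le (SPar a b) (SPar a' b')
| SI_comSl a b r r' a' b' :
    strans a (SLOutS r) a' -> strans b (SLInS r') b' -> le r r' ->
    sint le (SPar a b) (SPar a' b')
| SI_comSr a b r r' a' b' :
    strans a (SLInS r') a' -> strans b (SLOutS r) b' -> le r r' ->
    sint le (SPar a b) (SPar a' b')
| SI_failSl a b r r' a' b' :
    strans a (SLOutS r) a' -> strans b (SLInS r') b' -> ~ le r r' ->
    sint le (SPar a b) SZero
| SI_failSr a b r r' a' b' :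
    strans a (SLInS r') a' -> strans b (SLOutS r) b' -> ~ le r r' ->
    sint le (SPar a b) SZero.

Definition sints (S : values) (le : stree S -> stree S -> Prop) :
    stree S -> stree S -> Prop :=
  clos_refl_trans (stree S) (sint le).

Definition weak_trans (S : values) (le : stree S -> stree S -> Prop)
    (a : stree S) (m : slabel S) : Prop :=
  exists a' a'', sints le a a' /\ strans a' m a''.

Definition complete (S : values) (le : stree S -> stree S -> Prop)
    (a : stree S) : Prop :=
  forall a', sints le a a' -> weak_trans le a' Tick.

(* [le] solves the mutual definition of the transitions and of the preorder:
   it is the preorder obtained from the transitions that use it. *)
Definition is_preceq (S : values) (le : stree S -> stree S -> Prop) : Prop :=
  forall a b, session_type a -> session_type b ->
    (le a b <->
     forall r, session_type r ->
       complete le (SPar a r) -> complete le (SPar b r)).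

Definition sqsub (S : values) (le : stree S -> stree S -> Prop)
    (a b : stree S) : Prop :=
  forall r, session_type r -> le (SExt a r) (SExt b r).

(** * Expressions *)

Definition var_to_val (V : Type) (x : var) (v : V) : var -> var + V :=
  fun y => if y == x then inr v else inl y.

Definition swap (a b c : nat) : nat :=
  if c == a then b else if c == b then a else c.

(* The unspecified expression language, with its simultaneous substitution of
   variables and values for variables. *)
Record language (S : values) := Language {
  expr : Type;
  efv : expr -> seq var;
  esubst : (var -> var + bval S) -> expr -> expr;
  eval : expr -> bval S -> Prop;
  etyp : (var -> option (vtype S)) -> expr -> vtype S -> Prop;
  efv_esubst : forall s e y,
    y \in efv (esubst s e) <-> exists2 x, x \in efv e & s x = inl y;
  esubst_id : forall e, esubst inl e = e;
  esubst_comp : forall s s' e,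
    esubst s' (esubst s e) =
    esubst (fun x => match s x with inl y => s' y | inr v => inr v end) e;
  esubst_ext : forall s s' e,
    (forall x, x \in efv e -> s x = s' x) -> esubst s e = esubst s' e;
  etyp_subst : forall G x t v e t', G x = None ->
    etyp (upd G x t) e t' -> inhab v t -> etyp G (esubst (var_to_val x v) e) t';
  etyp_eval : forall G e t, efv e = [::] -> etyp G e t -> exists v, eval e v;
  etyp_sound : forall G e t v,
    efv e = [::] -> etyp G e t -> eval e v -> inhab v t }.

(** * Processes *)

Inductive action (S : values) (L : language S) : Type :=
| VIn (u : chan) (x : var) (t : vtype S)
| VOut (u : chan) (e : expr L)
| CIn (u : chan) (x : var)
| COut (u v : chan).
Arguments VIn {S L}.
Arguments VOut {S L}.
Arguments CIn {S L}.
Arguments COut {S L}.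

Inductive proc (S : values) (L : language S) : Type :=
| PNil
| PPre (pi : action L) (P : proc L)
| PBang (P : proc L)
| PExt (P Q : proc L)
| PInt (P Q : proc L)
| PPar (P Q : proc L)
| PNu (c : name) (P : proc L).
Arguments PNil {S L}.

Definition subj (S : values) (L : language S) (pi : action L) : chan :=
  match pi with
  | VIn u _ _ | VOut u _ | CIn u _ | COut u _ => u
  end.

Definition bound_var (S : values) (L : language S) (pi : action L) :
    option var :=
  match pi with
  | VIn _ x _ | CIn _ x => Some x
  | _ => None
  end.

Definition chan_fn (u : chan) : seq name := if u is inl c then [:: c] else [::].
Definition chan_fv (u : chan) : seq var := if u is inr x then [:: x] else [::].

Definition action_fn (S : values) (L : language S) (pi : action L) :
    seq name :=
  match pi with
  | VIn u _ _ | VOut u _ | CIn u _ => chan_fn u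
  | COut u v => chan_fn u ++ chan_fn v
  end.

Definition action_fv (S : values) (L : language S) (pi : action L) : seq var :=
  match pi with
  | VIn u _ _ | CIn u _ => chan_fv u
  | VOut u e => chan_fv u ++ efv e
  | COut u v => chan_fv u ++ chan_fv v
  end.

Fixpoint fn (S : values) (L : language S) (P : proc L) : seq name :=
  match P with
  | PNil => [::]
  | PPre pi P => action_fn pi ++ fn P
  | PBang P => fn P
  | PExt P Q | PInt P Q | PPar P Q => fn P ++ fn Q
  | PNu c P => [seq d <- fn P | d != c]
  end.

Fixpoint fv (S : values) (L : language S) (P : proc L) : seq var :=
  match P with
  | PNil => [::]
  | PPre pi P => action_fv pi ++ [seq x <- fv P | bound_var pi != Some x]
  | PBang P | PNu _ P => fv P
  | PExt P Q | PInt P Q | PPar P Q => fv P ++ fv Q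
  end.

(* Transitions only make sense for closed processes: c!y.0 | c?(x).0, with [y]
   a free variable, is typable with the complete type !1.1 | ?1.1 for [c] but is
   stuck, since only names can be communicated. *)
Definition closed_proc (S : values) (L : language S) (P : proc L) : Prop :=
  fv P = [::].

Fixpoint restricted (S : values) (L : language S) (P : proc L) : seq name :=
  match P with
  | PNil => [::]
  | PPre _ P | PBang P => restricted P
  | PExt P Q | PInt P Q | PPar P Q => restricted P ++ restricted Q
  | PNu c P => c :: restricted P
  end.

(** ** Renaming and alpha-conversion *)

Definition chan_map (f : name -> name) (g : var -> var) (u : chan) : chan :=
  match u with
  | inl c => Name (f c)
  | inr x => Var (g x)
  end.

(* Applies [f] and [g] to all names and variables, bound ones included. *)
Fixpoint rename (S : values) (L : language S) (f : name -> name)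
    (g : var -> var) (P : proc L) : proc L :=
  match P with
  | PNil => PNil
  | PPre pi P =>
      PPre (match pi with
            | VIn u x t => VIn (chan_map f g u) (g x) t
            | VOut u e =>
                VOut (chan_map f g u) (esubst (fun x => inl (g x)) e)
            | CIn u x => CIn (chan_map f g u) (g x)
            | COut u v => COut (chan_map f g u) (chan_map f g v)
            end) (rename f g P)
  | PBang P => PBang (rename f g P)
  | PExt P Q => PExt (rename f g P) (rename f g Q)
  | PInt P Q => PInt (rename f g P) (rename f g Q)
  | PPar P Q => PPar (rename f g P) (rename f g Q)
  | PNu c P => PNu (f c) (rename f g P)
  end.

Definition swap_names (S : values) (L : language S) (c d : name) (P : proc L) :
    proc L :=
  rename (swap c d) id P.

Definition swap_vars (S : values) (L : language S) (x y : var) (P : proc L) :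
    proc L :=
  rename id (swap x y) P.

(* Swapping [c] with a [d] that is not free amounts to renaming [c] to [d]
   without capture. *)
Inductive alpha (S : values) (L : language S) : proc L -> proc L -> Prop :=
| A_nu c d P :
    d \notin fn P -> alpha (PNu c P) (PNu d (swap_names c d P))
| A_vin u x y t P :
    y \notin fv P ->
    alpha (PPre (VIn u x t) P) (PPre (VIn u y t) (swap_vars x y P))
| A_cin u x y P :
    y \notin fv P ->
    alpha (PPre (CIn u x) P) (PPre (CIn u y) (swap_vars x y P))
| A_refl P : alpha P P
| A_sym P Q : alpha P Q -> alpha Q P
| A_trans P Q R : alpha P Q -> alpha Q R -> alpha P R
| A_pre pi P P' : alpha P P' -> alpha (PPre pi P) (PPre pi P')
| A_bang P P' : alpha P P' -> alpha (PBang P) (PBang P')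
| A_ext P P' Q Q' : alpha P P' -> alpha Q Q' -> alpha (PExt P Q) (PExt P' Q')
| A_int P P' Q Q' : alpha P P' -> alpha Q Q' -> alpha (PInt P Q) (PInt P' Q')
| A_par P P' Q Q' : alpha P P' -> alpha Q Q' -> alpha (PPar P Q) (PPar P' Q')
| A_nucongr c P P' : alpha P P' -> alpha (PNu c P) (PNu c P').

(** ** Transitions *)

Inductive msg (S : values) : Type :=
| MVal (v : bval S)
| MName (d : name).
Arguments MName {S}.

Definition chan_subst (S : values) (m : msg S) (x : var) (u : chan) : chan :=
  match m, u with
  | MName d, inr y => if y == x then Name d else u
  | _, _ => u
  end.

Definition expr_subst (S : values) (L : language S) (m : msg S) (x : var)
    (e : expr L) : expr L :=
  if m is MVal v then esubst (var_to_val x v) e else e.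

(* Restrictions are not renamed on the way: [m] must not be a name in
   [restricted P] (see [R_cin]). *)
Fixpoint subst (S : values) (L : language S) (m : msg S) (x : var)
    (P : proc L) : proc L :=
  match P with
  | PNil => PNil
  | PPre pi P =>
      PPre (match pi with
            | VIn u y t => VIn (chan_subst m x u) y t
            | VOut u e => VOut (chan_subst m x u) (expr_subst m x e)
            | CIn u y => CIn (chan_subst m x u) y
            | COut u v => COut (chan_subst m x u) (chan_subst m x v)
            end)
           (if bound_var pi == Some x then P else subst m x P)
  | PBang P => PBang (subst m x P)
  | PExt P Q => PExt (subst m x P) (subst m x Q)
  | PInt P Q => PInt (subst m x P) (subst m x Q)
  | PPar P Q => PPar (subst m x P) (subst m x Q)
  | PNu c P => PNu c (subst m x P)
  end.

Inductive label (S : values) : Type :=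
| Tau
| In (c : name) (m : msg S)
| Out (c : name) (m : msg S)
| BOut (c d : name).
Arguments Tau {S}.
Arguments BOut {S}.

Definition msg_fn (S : values) (m : msg S) : seq name :=
  if m is MName d then [:: d] else [::].

Definition label_fn (S : values) (l : label S) : seq name :=
  match l with
  | Tau => [::]
  | In c m | Out c m => c :: msg_fn m
  | BOut c _ => [:: c]
  end.

Definition label_bn (S : values) (l : label S) : seq name :=
  if l is BOut _ d then [:: d] else [::].

(* [R_alpha] expresses that processes are identified up to alpha-conversion. *)
Inductive step (S : values) (L : language S) :
    proc L -> label S -> proc L -> Prop :=
| R_alpha P P1 l Q1 Q :
    alpha P P1 -> step P1 l Q1 -> alpha Q1 Q -> step P l Q
| R_intl P Q : step (PInt P Q) Tau P
| R_intr P Q : step (PInt P Q) Tau Q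
| R_bang P : step (PBang P) Tau (PPar (PBang P) P)
| R_cin c x d P :
    d \notin restricted P ->
    step (PPre (CIn (Name c) x) P) (In c (MName d)) (subst (MName d) x P)
| R_cout c d P :
    step (PPre (COut (Name c) (Name d)) P) (Out c (MName d)) P
| R_vin c x t v P :
    inhab v t ->
    step (PPre (VIn (Name c) x t) P) (In c (MVal v)) (subst (MVal v) x P)
| R_vout c e v P :
    eval e v -> step (PPre (VOut (Name c) e) P) (Out c (MVal v)) P
| R_exttaul P Q P' : step P Tau P' -> step (PExt P Q) Tau (PExt P' Q)
| R_exttaur P Q Q' : step Q Tau Q' -> step (PExt P Q) Tau (PExt P Q')
| R_extl P Q l P' : l <> Tau -> step P l P' -> step (PExt P Q) l P'
| R_extr P Q l Q' : l <> Tau -> step Q l Q' -> step (PExt P Q) l Q'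
| R_coml P Q c m P' Q' :
    step P (Out c m) P' -> step Q (In c m) Q' ->
    step (PPar P Q) Tau (PPar P' Q')
| R_comr P Q c m P' Q' :
    step P (In c m) P' -> step Q (Out c m) Q' ->
    step (PPar P Q) Tau (PPar P' Q')
| R_closel P Q c d P' Q' :
    step P (BOut c d) P' -> step Q (In c (MName d)) Q' -> d \notin fn Q ->
    step (PPar P Q) Tau (PNu d (PPar P' Q'))
| R_closer P Q c d P' Q' :
    step P (In c (MName d)) P' -> step Q (BOut c d) Q' -> d \notin fn P ->
    step (PPar P Q) Tau (PNu d (PPar P' Q'))
| R_parl P Q l P' :
    step P l P' -> (forall d, d \in label_bn l -> d \notin fn Q) ->
    step (PPar P Q) l (PPar P' Q)
| R_parr P Q l Q' :
    step Q l Q' -> (forall d, d \in label_bn l -> d \notin fn P) ->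
    step (PPar P Q) l (PPar P Q')
| R_nu d P l P' :
    step P l P' -> d \notin label_fn l ++ label_bn l ->
    step (PNu d P) l (PNu d P')
| R_open c d P P' :
    step P (Out c (MName d)) P' -> c <> d -> step (PNu d P) (BOut c d) P'.

(** ** Typing *)

Definition same_dom (K V : Type) (D E : K -> option V) : Prop :=
  forall u, D u = None <-> E u = None.

Definition par_env (S : values) (D E : chan -> option (stree S)) :
    chan -> option (stree S) :=
  fun u => match D u, E u with
           | Some a, Some b => Some (SPar a b)
           | _, _ => None
           end.

(* [iter_ext l P a]: [P] and [a] are the iterated external choices of the
   prefixed processes and of the session types in the nonempty list [l]; any
   bracketing is allowed. *)
Inductive iter_ext (S : values) (L : language S) :
    list (action L * proc L * stree S) -> proc L -> stree S -> Prop :=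
| IE_one pi P a : iter_ext (cons (pi, P, a) nil) (PPre pi P) a
| IE_app l1 l2 P Q a b :
    iter_ext l1 P a -> iter_ext l2 Q b ->
    iter_ext (l1 ++ l2) (PExt P Q) (SExt a b).

(* [upd D u a] under the premise [D u = None] is a disjoint union.  A bound
   variable is required not to occur in the environments; [T_alpha] makes this
   harmless. *)
Inductive typed (S : values) (L : language S)
    (le : stree S -> stree S -> Prop) :
    (var -> option (vtype S)) -> proc L -> (chan -> option (stree S)) -> Prop :=
| T_alpha G P P' D : alpha P P' -> typed le G P D -> typed le G P' D
| T_weak G P D u :
    typed le G P D -> D u = None -> typed le G P (upd D u SOne)
| T_sub G P D u a b :
    D u = None -> typed le G P (upd D u b) ->
    session_type a -> sqsub le a b -> typed le G P (upd D u a)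
| T_res G P D c a :
    D (Name c) = None -> typed le G P (upd D (Name c) (SExt SOne a)) ->
    typed le G (PNu c P) D
| T_nil G : typed le G PNil (@emptyenv chan (stree S))
| T_input G P D u x t a :
    D u = None -> G x = None -> upd D u a (Var x) = None ->
    typed le (upd G x t) P (upd D u a) ->
    typed le G (PPre (VIn u x t) P) (upd D u (SInV t a))
| T_inputS G P u x r :
    G x = None -> typed le G P (upd (@emptyenv chan (stree S)) (Var x) r) ->
    typed le G (PPre (CIn u x) P)
      (upd (@emptyenv chan (stree S)) u (SInS r SOne))
| T_output G P D u e t a :
    D u = None -> etyp G e t -> typed le G P (upd D u a) ->
    typed le G (PPre (VOut u e) P) (upd D u (SOutV t a))
| T_outputS G P D u v r a b :
    D u = None -> D v = None -> u <> v -> session_type r ->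
    typed le G P (upd (upd D u a) v b) ->
    typed le G (PPre (COut u v) P) (upd (upd D u (SOutS r a)) v (SPar b r))
| T_ext G D u l P a :
    D u = None ->
    (forall pi Q b, List.In (pi, Q, b) l -> subj pi = u) ->
    (forall pi Q b, List.In (pi, Q, b) l ->
       typed le G (PPre pi Q) (upd D u b)) ->
    iter_ext l P a ->
    typed le G P (upd D u a)
| T_int G P Q D : typed le G P D -> typed le G Q D -> typed le G (PInt P Q) D
| T_bang G P D :
    typed le G P D ->
    (forall u a, D u = Some a -> sqsub le a (SPar a a)) ->
    typed le G (PBang P) D
| T_par G P Q D E :
    same_dom D E -> typed le G P D -> typed le G Q E ->
    typed le G (PPar P Q) (par_env D E).

Definition session_env (S : values) (D : chan -> option (stree S)) : Prop :=
  forall u a, D u = Some a -> session_type a.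

(** ** Readiness *)

Inductive ready (S : values) (L : language S) : proc L -> name -> Prop :=
| RD_pre pi P c : subj pi = Name c -> ready (PPre pi P) c
| RD_notfree P c : c \notin fn P -> ready P c
| RD_ext P Q c : ready P c -> ready Q c -> ready (PExt P Q) c
| RD_par P Q c : ready P c -> ready Q c -> ready (PPar P Q) c
| RD_nu P c d : ready P c -> c <> d -> ready (PNu d P) c.

(* Main.v *)
(* Undoing subsumption, a process that is ready on [c] and cannot reduce has for
   [c] a type which is a parallel composition of sums of prefixes, one for each
   component that is a sum of prefixes on [c], and of copies of [1], one for each
   component in which [c] is not free.  Once the values to be sent are chosen,
   this type is stuck too: a communication in it, successful or not, would come
   with a communication of the process.  Being above a complete type, it is
   complete, so that it can immediately perform a tick; but sums of prefixes
   cannot, so there are none of them and [c] is not free. *)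

Require Import Defs.
From mathcomp Require Import all_boot.
From Stdlib Require Import Classical Relation_Operators Operators_Properties.

Set Implicit Arguments.
Unset Strict Implicit.
Unset Printing Implicit Defensive.

(** Two obstacles shape the proof. Subsumption may be used anywhere in a derivation, so it has to be
    undone component by component, and the types found below it reassembled. This takes
    compatibility of the preorder with sums and with parallel composition, available only between
    session types, so that well-formedness is tracked throughout. On the process side, a delegated
    name may be restricted. The process then answers the type with a scope extrusion, whose bound
    name must avoid the names of every surrounding component, and a receiver must be able to accept
    any name at all. A transition of a type is therefore matched not with a single transition of the
    process but with a capability that holds for all choices of names, and this capability has to
    pass through restrictions and parallel compositions. *)

Local Ltac inv H := inversion H; subst; clear H.
Local Ltac zero_step := solve [match goal with
  | H : strans SZero _ _ |- _ => inversion H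
  | H : sint _ SZero _ |- _ => inversion H
  end].

(** * Well-formed session types *)

Lemma bisim_refl (S : values) (T : stree S) : bisim T T.
Proof. by move: T; cofix IH; case=> *; constructor; apply: IH. Qed.

Lemma has_weight_mono (S : values) (n m : nat) (T : stree S) :
  n <= m -> has_weight n T -> has_weight m T.
Proof.
elim: n m T => [|n IH] m T le_nm wT; last case: m le_nm => [//|m] le_nm.
  case: m le_nm => [|m] _ //= p s r sp sr; by have := wT p s r sp sr.
by move=> p s r sp sr; apply: IH (wT p s r sp sr).
Qed.

(** Every clause of the definition concerns the subtrees along paths, and a node adds to those of
    its children one subtree, one path and at most one message. This single argument serves all
    constructors. *)
Lemma session_type_child (S : values) (T : stree S) :
  (forall d T', child d T = Some T' -> session_type T') -> session_type T.
Proof.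
move=> sT; split.
- have reg d : exists l : list (stree S), forall p s,
      subtree_at (d :: p) T = Some s -> exists s', List.In s' l /\ bisim s s'.
    move=> /=; case cd: (child d T) => [T'|]; last by exists nil.
    by case: (sT _ _ cd).
  case: (reg true) (reg false) => [l1 h1] [l2 h2].
  exists (cons T (l1 ++ l2)) => -[|[] p] s sp.
  + by case: sp => <-; exists T; split; [left|apply: bisim_refl].
  + case: (h1 p s sp) => s' [ins bis]; exists s'; split=> //.
    by right; apply: List.in_or_app; left.
  + case: (h2 p s sp) => s' [ins bis]; exists s'; split=> //.
    by right; apply: List.in_or_app; right.
- move=> f f0 fS n; have [d] := fS 0; rewrite f0 => /sT [_ cT _ _].
  case: (cT (fun n => f n.+1) erefl (fun n => fS n.+1) n) => m [nm pm].
  by exists m.+1; split=> //; apply: leqW.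
- have fin d : exists l : seq (seq bool), forall p a b,
      subtree_at (d :: p) T = Some (SPar a b) -> p \in l.
    move=> /=; case cd: (child d T) => [T'|]; last by exists [::].
    by case: (sT _ _ cd).
  case: (fin true) (fin false) => [l1 h1] [l2 h2].
  exists ([::] :: map (cons true) l1 ++ map (cons false) l2).
  move=> [|[] p] a b sp; rewrite ?inE ?mem_cat //.
  + by rewrite (map_f (cons true) (h1 p a b sp)) !orbT.
  + by rewrite (map_f (cons false) (h2 p a b sp)) !orbT.
- have wt d : exists n, forall T', child d T = Some T' -> has_weight n T'.
    case cd: (child d T) => [T'|]; last by exists 0.
    by case: (sT _ _ cd) => _ _ _ [n wn]; exists n => _ [<-].
  case: (wt true) (wt false) => [n1 h1] [n2 h2].
  have w d T' : child d T = Some T' -> has_weight (maxn n1 n2) T'.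
    case: d => cT; [apply: has_weight_mono (h1 _ cT)
                   |apply: has_weight_mono (h2 _ cT)]; by rewrite ?leq_maxl ?leq_maxr.
  (* The successor accounts for a message at the root, which is itself a child and so has weight at
     most the maximum. *)
  exists (maxn n1 n2).+1 => -[|d p] s r /=.
    move=> [<-] mT; apply: (w false).
    by case: (T) mT => //= ? ? [->].
  case cd: (child d T) => [T'|//] sp sr.
  have := has_weight_mono (leqnSn _) (w _ _ cd).
  by move/(_ p s r sp sr).
Qed.

Lemma session_zero (S : values) : session_type (@SZero S).
Proof. by apply: session_type_child. Qed.

Lemma session_one (S : values) : session_type (@SOne S).
Proof. by apply: session_type_child. Qed.

Lemma session_inV (S : values) t (a : stree S) :
  session_type a -> session_type (SInV t a).
Proof. by move=> sa; apply: session_type_child => -[] //= T [<-]. Qed.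

Lemma session_outV (S : values) t (a : stree S) :
  session_type a -> session_type (SOutV t a).
Proof. by move=> sa; apply: session_type_child => -[] //= T [<-]. Qed.

Lemma session_inS (S : values) (r a : stree S) :
  session_type r -> session_type a -> session_type (SInS r a).
Proof. by move=> sr sa; apply: session_type_child => -[] //= T [<-]. Qed.

Lemma session_outS (S : values) (r a : stree S) :
  session_type r -> session_type a -> session_type (SOutS r a).
Proof. by move=> sr sa; apply: session_type_child => -[] //= T [<-]. Qed.

Lemma session_ext (S : values) (a b : stree S) :
  session_type a -> session_type b -> session_type (SExt a b).
Proof. by move=> sa sb; apply: session_type_child => -[] //= T [<-]. Qed.

Lemma session_par (S : values) (a b : stree S) :
  session_type a -> session_type b -> session_type (SPar a b).
Proof. by move=> sa sb; apply: session_type_child => -[] //= T [<-]. Qed.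

#[local] Hint Resolve session_zero session_one session_inV session_outV
  session_inS session_outS session_ext session_par : core.

(** * Completeness and the subtyping relations *)

Section Completeness.
Variables (S : values) (le : stree S -> stree S -> Prop).
Implicit Types a b r t : stree S.

Definition dead a := ~ weak_trans le a Tick.

Lemma complete_step a b : sints le a b -> complete le a -> complete le b.
Proof. by move=> ab ca b' bb'; apply: ca; apply: rt_trans ab bb'. Qed.

Lemma weak_trans_step a b m : sint le a b -> weak_trans le b m -> weak_trans le a m.
Proof.
move=> ab [b' [b'' [bb' b'm]]]; exists b', b''; split=> //.
by apply: rt_trans bb'; apply: rt_step.
Qed.

(* The dead types are for failed delegations: such a failure turns into [SZero]
   the innermost parallel composition around it only, so that [|] is not
   associative up to a plain bisimulation. *)
Lemma complete_sim (R : stree S -> stree S -> Prop) :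
  (forall a b b', R a b -> sint le b b' ->
     (exists a', sint le a a' /\ R a' b') \/
     (exists a', sint le a a' /\ dead a')) ->
  (forall a b a', R a b -> sint le a a' ->
     dead a' \/ exists b', sint le b b' /\ R a' b') ->
  (forall a b a', R a b -> strans a Tick a' -> exists b', strans b Tick b') ->
  forall a b, R a b -> complete le a -> complete le b.
Proof.
move=> back forth tick a b ab ca b' bb0; have {bb0} bb' := clos_rt_rt1n _ _ _ _ bb0.
(* Completeness of [a] is carried along the moves of [b]; a dead type at any point would contradict
   it. Afterwards a single weak tick remains to be transferred. *)
have {a ab ca bb'} [a [ab [a' [a'' [aa' a'm]]]]] :
    exists a, R a b' /\ weak_trans le a Tick.
  elim: bb' a ab ca => [{}b a ab ca|{}b b1 {}b' bb1 _ IH a ab ca].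
    by exists a; split=> //; apply: ca; apply: rt_refl.
  case: (back _ _ _ ab bb1) => -[a1 [aa1 h]].
    by apply: (IH a1) => //; apply: complete_step ca; apply: rt_step.
  by case: h; apply: ca; apply: rt_step.
have {}aa' := clos_rt_rt1n _ _ _ _ aa'.
(* The path of [a] to its tick is followed on the other side; it meets no dead type, because it ends
   in a tick. *)
elim: aa' b' ab a'm => [{}a c ac at_|{}a a1 {}a' aa1 a1a' IH c ac at_].
  have [b' bt] := tick _ _ _ ac at_.
  by exists c, b'; split=> //; apply: rt_refl.
case: (forth _ _ _ ac aa1) => [da|[b1 [bb1 a1b1]]].
  by case: da; exists a', a''; split=> //; apply: clos_rt1n_rt.
by apply: weak_trans_step bb1 _; apply: IH.
Qed.

Lemma dead_zero : dead SZero.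
Proof.
move=> [a' [a'' [aa' am]]]; have {aa'} aa' := clos_rt_rt1n _ _ _ _ aa'.
by inv aa'; [inv am | inv H].
Qed.

(** [SZero] has no transition, so it remains a component forever, and a parallel composition ticks
    only if both components do. *)
Lemma dead_parl a : dead (SPar SZero a).
Proof.
move=> [a' [a'' [aa' am]]]; have {aa'} aa' := clos_rt_rt1n _ _ _ _ aa'.
have [b eb] : exists b, a' = SPar SZero b.
  move E: (SPar _ _) aa' => c ca'.
  elim: ca' a E => {c a' am} [c|c c' a' cc' _ IH] a E; first by exists a.
  subst c; inv cc'; try zero_step.
  by apply: IH.
by subst a'; inv am => //; zero_step.
Qed.

Lemma dead_parr a : dead (SPar a SZero).
Proof.
move=> [a' [a'' [aa' am]]]; have {aa'} aa' := clos_rt_rt1n _ _ _ _ aa'.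
have [b eb] : exists b, a' = SPar b SZero.
  move E: (SPar _ _) aa' => c ca'.
  elim: ca' a E => {c a' am} [c|c c' a' cc' _ IH] a E; first by exists a.
  subst c; inv cc'; try zero_step.
  by apply: IH.
by subst a'; inv am => //; zero_step.
Qed.

#[local] Hint Constructors strans sint : core.
#[local] Hint Resolve dead_zero dead_parl dead_parr : core.
#[local] Hint Extern 1 (_ <> Tick) => discriminate : core.

(** * Parallel composition up to commutativity and associativity *)

Lemma complete_parC a b : complete le (SPar a b) -> complete le (SPar b a).
Proof.
apply: (complete_sim (R := fun x y => exists a b, x = SPar a b /\ y = SPar b a));
  last by exists a, b.
- move=> _ _ y' [c [d [-> ->]]] st.
  by inv st; solve
    [ left; eexists; (split; [|do 2 eexists; split; reflexivity]); eauto
    | right; exists SZero; eauto].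
- move=> _ _ y' [c [d [-> ->]]] st.
  by inv st; solve
    [ left; eauto
    | right; eexists; (split; [|do 2 eexists; split; reflexivity]); eauto ].
- by move=> _ _ y' [c [d [-> ->]]] st; inv st => //; eexists; eauto.
Qed.

(** The bracketings differ only on failed delegations: one side may become [SPar SZero c] or
    [SPar a SZero] where the other becomes [SZero]. All of these are dead, the alternative that
    [complete_sim] permits. *)
Lemma complete_parA a b c :
  complete le (SPar (SPar a b) c) -> complete le (SPar a (SPar b c)).
Proof.
apply: (complete_sim (R := fun x y => exists a b c,
  x = SPar (SPar a b) c /\ y = SPar a (SPar b c))); last by exists a, b, c.
- move=> _ _ y' [d [e [f [-> ->]]]] st.
  by inv st; repeat match goal with
    | H : sint _ (SPar _ _) _ |- _ => inv H
    | H : strans (SPar _ _) _ _ |- _ => inv H end; solve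
    [ left; eexists; (split; [|do 3 eexists; split; reflexivity]); eauto
    | right; exists SZero; eauto
    | right; exists (SPar SZero f); eauto].
- move=> _ _ y' [d [e [f [-> ->]]]] st.
  by inv st; repeat match goal with
    | H : sint _ (SPar _ _) _ |- _ => inv H
    | H : strans (SPar _ _) _ _ |- _ => inv H end; solve
    [ left; eauto
    | right; eexists; (split; [|do 3 eexists; split; reflexivity]); eauto ].
- move=> _ _ y' [d [e [f [-> ->]]]] st.
  by inv st => //; inv H1 => //; eexists; eauto.
Qed.

(** * External choice up to commutativity, associativity and unit *)

Inductive ext_eq : stree S -> stree S -> Prop :=
| EE_C a b : ext_eq (SExt a b) (SExt b a)
| EE_A a b c : ext_eq (SExt (SExt a b) c) (SExt a (SExt b c))
| EE_intro a : ext_eq a (SExt a SZero)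
| EE_elim a : ext_eq (SExt a SZero) a.

Lemma ext_eq_strans a b m t : ext_eq a b -> strans a m t -> strans b m t.
Proof.
case=> *; repeat match goal with
    | H : strans (SExt _ _) _ _ |- _ => inv H
    | H : strans SZero _ _ |- _ => inv H end; eauto.
Qed.

Lemma ext_eq_strans' a b m t : ext_eq a b -> strans b m t -> strans a m t.
Proof.
case=> *; repeat match goal with
    | H : strans (SExt _ _) _ _ |- _ => inv H
    | H : strans SZero _ _ |- _ => inv H end; eauto.
Qed.

#[local] Hint Constructors ext_eq : core.

Lemma ext_eq_sint a b a' :
  ext_eq a b -> sint le a a' -> exists b', sint le b b' /\ ext_eq a' b'.
Proof.
case=> *; solve [eauto | repeat match goal with
    | H : sint _ (SExt _ _) _ |- _ => inv H
    | H : sint _ SZero _ |- _ => inv H end; eauto 6].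
Qed.

Lemma ext_eq_sint' a b b' :
  ext_eq a b -> sint le b b' -> exists a', sint le a a' /\ ext_eq a' b'.
Proof.
case=> *; solve [repeat match goal with
    | H : sint _ (SExt _ _) _ |- _ => inv H
    | H : sint _ SZero _ |- _ => inv H end; eauto 6 | eauto].
Qed.

(** An internal move of the choice keeps an instance of some law, while a communication discards the
    choice and leaves equal types on both sides. Hence the disjunct [x = y] in the relation. *)
Lemma complete_ext_eq a b r :
  ext_eq a b -> complete le (SPar a r) -> complete le (SPar b r).
Proof.
move=> ab.
apply: (complete_sim (R := fun x y => x = y \/ exists a b r,
  [/\ ext_eq a b, x = SPar a r & y = SPar b r])); last by right; exists a, b, r.
- move=> x y y' [->|[c [d [s [cd -> ->]]]]] st; first by left; eauto.
  inv st; try solve [left; eexists; split; [|left; reflexivity];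
    have := ext_eq_strans' cd; eauto].
  + have [c' [cc' cd']] := ext_eq_sint' cd H2.
    by left; exists (SPar c' s); split; eauto; right; exists c', a', s.
  + by left; exists (SPar c b'); split; eauto; right; exists c, d, b'.
- move=> x y x' [->|[c [d [s [cd -> ->]]]]] st; first by right; eauto.
  inv st; try solve [right; eexists; split; [|left; reflexivity];
    have := ext_eq_strans cd; eauto].
  + have [d' [dd' cd']] := ext_eq_sint cd H2.
    by right; exists (SPar d' s); split; eauto; right; exists a', d', s.
  + by right; exists (SPar d b'); split; eauto; right; exists c, d, b'.
- move=> x y x' [->|[c [d [s [cd -> ->]]]]] st; first by eauto.
  by inv st => //; have := ext_eq_strans cd; eauto.
Qed.

(** * Compatibility of the preorders with the operators *)

Definition par_sub a b :=
  forall r, session_type r -> complete le (SPar a r) -> complete le (SPar b r).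

(** Needed for sums, where [par_sub] is too weak: [SZero] is [par_sub]-below every type, since no
    composition with it is complete, but as a summand it cannot be replaced by an arbitrary type. *)
Definition ext_sub a b :=
  forall r, session_type r -> par_sub (SExt a r) (SExt b r).

Lemma par_sub_trans b a c : par_sub a b -> par_sub b c -> par_sub a c.
Proof. by move=> ab bc r sr /(ab r sr)/(bc r sr). Qed.

Lemma ext_sub_trans b a c : ext_sub a b -> ext_sub b c -> ext_sub a c.
Proof. by move=> ab bc r sr; apply: par_sub_trans (ab r sr) (bc r sr). Qed.

(** The summand [SZero] can be inserted and removed without affecting completeness. *)
Lemma ext_sub_par_sub a b : ext_sub a b -> par_sub a b.
Proof.
move=> ab r sr cr; apply: (complete_ext_eq (EE_elim b)).
by apply: ab => //; apply: complete_ext_eq cr.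
Qed.

(** One component is replaced at a time, the other one joining the context. The contexts are
    [SPar a2 r] and [SPar r b1], whence the two well-formedness hypotheses. *)
Lemma par_sub_par a1 a2 b1 b2 : session_type a2 -> session_type b1 ->
  par_sub a1 b1 -> par_sub a2 b2 -> par_sub (SPar a1 a2) (SPar b1 b2).
Proof.
move=> s2 s1 ab1 ab2 r sr /complete_parA /(ab1 _ (session_par s2 sr)).
move/complete_parC/complete_parA/(ab2 _ (session_par sr s1)).
by move/complete_parC/complete_parA/complete_parC.
Qed.

Lemma ext_sub_ext a1 a2 b1 b2 : session_type a2 -> session_type b1 ->
  ext_sub a1 b1 -> ext_sub a2 b2 -> ext_sub (SExt a1 a2) (SExt b1 b2).
Proof.
move=> s2 s1 ab1 ab2 t st r sr /(complete_ext_eq (EE_A _ _ _)).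
move/(ab1 _ (session_ext s2 st) _ sr).
move/(complete_ext_eq (EE_C _ _))/(complete_ext_eq (EE_A _ _ _)).
move/(ab2 _ (session_ext st s1) _ sr).
move/(complete_ext_eq (EE_C _ _))/(complete_ext_eq (EE_A _ _ _)).
by move/(complete_ext_eq (EE_C _ _)).
Qed.

(** An internal move of a summand is one of the whole sum, and completeness is inherited by reducts.
    It serves to fix the value of an output. *)
Lemma ext_sub_sint a b : sint le a b -> ext_sub a b.
Proof. by move=> ab r sr t st; apply: complete_step; apply: rt_step; eauto. Qed.

(** The one point where the equation defining [le] is used. It determines [le] between session types
    only, so the rest of the argument works with the unfolded relations. *)
Lemma sqsub_ext_sub a b : is_preceq le ->
  session_type a -> session_type b -> sqsub le a b -> ext_sub a b.
Proof.
move=> Hle sa sb ab r sr.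
by have [/(_ (ab r sr))] := Hle _ _ (session_ext sa sr) (session_ext sb sr).
Qed.

(** Puts completeness of a type by itself in the form of completeness in a context, on which
    [par_sub] can act; [SOne] only ever ticks. *)
Lemma complete_par_one a : complete le a -> complete le (SPar a SOne).
Proof.
apply: (complete_sim (R := fun x y => y = SPar x SOne)) => //.
- move=> x _ y' -> st; left; inv st;
    try by match goal with
    | H : strans SOne _ _ |- _ => inv H
    | H : sint _ SOne _ |- _ => inv H end.
  by eauto.
- by move=> x _ x' -> st; right; eauto.
- by move=> x _ x' -> st; eauto.
Qed.

End Completeness.

(** * Alpha-conversion and renaming *)

Section Processes.
Variables (S : values) (L : language S).
Implicit Types (P Q : proc L) (f : name -> name) (g : var -> var) (pi : action L).

Lemma swap_inv a b : involutive (swap a b).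
Proof.
move=> c; rewrite /swap; case: (eqVneq c a) => [->|ca]; first by rewrite eqxx; case: eqVneq.
case: (eqVneq c b) => [->|cb]; first by rewrite eqxx.
by rewrite (negPf ca) (negPf cb).
Qed.

Lemma swap_inj a b : injective (swap a b).
Proof. exact: inv_inj (swap_inv a b). Qed.

Lemma swapD a b c : c != a -> c != b -> swap a b c = c.
Proof. by rewrite /swap => /negPf-> /negPf->. Qed.

Lemma swap_morph f a b c : injective f -> f (swap a b c) = swap (f a) (f b) (f c).
Proof. by move=> fI; rewrite /swap !(inj_eq fI); do 2 case: ifP => //. Qed.

Lemma chan_map_comp f1 g1 f2 g2 u :
  chan_map f2 g2 (chan_map f1 g1 u) = chan_map (f2 \o f1) (g2 \o g1) u.
Proof. by case: u. Qed.

Lemma chan_map_eq f1 g1 f2 g2 : f1 =1 f2 -> g1 =1 g2 ->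
  chan_map f1 g1 =1 chan_map f2 g2.
Proof. by move=> ef eg [c|x] /=; rewrite ?ef ?eg. Qed.

Lemma rename_comp f1 g1 f2 g2 P :
  rename f2 g2 (rename f1 g1 P) = rename (f2 \o f1) (g2 \o g1) P.
Proof.
elim: P => //= [[u x t|u e|u x|u v] P ->|P ->|P -> Q ->|P -> Q ->|P -> Q ->|c P ->] //;
  rewrite ?chan_map_comp // esubst_comp.
by [].
Qed.

Lemma eq_rename f1 g1 f2 g2 : f1 =1 f2 -> g1 =1 g2 ->
  forall P, rename f1 g1 P = rename f2 g2 P.
Proof.
move=> ef eg; have ec := chan_map_eq ef eg.
elim=> //= [[u x t|u e|u x|u v] P ->|P ->|P -> Q ->|P -> Q ->|P -> Q ->|c P ->] //;
  rewrite ?ec ?ef ?eg //; congr (PPre (VOut _ _) _).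
by apply: esubst_ext => x _; rewrite eg.
Qed.

Lemma rename_id P : rename id id P = P.
Proof.
have ec u : chan_map id id u = u by case: u.
elim: P => //= [[u x t|u e|u x|u v] P ->|P ->|P -> Q ->|P -> Q ->|P -> Q ->|c P ->] //;
  by rewrite ?ec ?esubst_id.
Qed.

Lemma fn_rename f g P : injective f -> fn (rename f g P) = map f (fn P).
Proof.
move=> fI.
have ec u : chan_fn (chan_map f g u) = map f (chan_fn u) by case: u.
elim: P => //= [[u x t|u e|u x|u v] P ->|P -> Q ->|P -> Q ->|P -> Q ->|c P ->] /=;
  rewrite ?map_cat ?ec //.
by rewrite filter_map; congr map; apply: eq_filter => d /=; rewrite (inj_eq fI).
Qed.

(** Stated up to membership because [efv_esubst] specifies the free variables of an expression as a
    set. *)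
Lemma fv_rename f g P : injective g -> fv (rename f g P) =i map g (fv P).
Proof.
move=> gI.
have ec u : chan_fv (chan_map f g u) = map g (chan_fv u) by case: u.
have ee e : efv (esubst (fun x => inl (g x)) e) =i map g (efv e).
  move=> y; apply/idP/mapP => [/efv_esubst [x xe [<-]]|[x xe ->]]; first by exists x.
  by apply/efv_esubst; exists x.
have fl (o : option var) P1 : fv (rename f g P1) =i map g (fv P1) ->
    [seq x <- fv (rename f g P1) | omap g o != Some x] =i
    map g [seq x <- fv P1 | o != Some x].
  move=> IH y; rewrite mem_filter IH; apply/andP/mapP => [[oy /mapP [x xP ey]]|].
    exists x => //; rewrite mem_filter xP andbT.
    by apply: contra oy => /eqP ->; rewrite /= ey.
  move=> [x]; rewrite mem_filter => /andP [ox xP] ->; split; last exact: map_f.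
  by case: o ox => //= z; rewrite !(inj_eq (@Some_inj _)) (inj_eq gI).
elim: P => //= [pi P IH|P IHP Q IHQ|P IHP Q IHQ|P IHP Q IHQ] y;
  rewrite map_cat !mem_cat ?IHP ?IHQ //.
have := fl (bound_var pi) P IH y.
by case: pi => [u x t|u e|u x|u v] /= ->;
  rewrite ?map_cat ?mem_cat ?ec ?ee.
Qed.

Lemma restricted_rename f g P : restricted (rename f g P) = map f (restricted P).
Proof.
by elim: P => //= [P -> Q ->|P -> Q ->|P -> Q ->|c P ->]; rewrite ?map_cat.
Qed.

Lemma alpha_fn P Q : alpha P Q -> fn P =i fn Q.
Proof.
elim=> {P Q} //=.
- move=> c d P dP e; rewrite fn_rename; last exact: swap_inj.
  rewrite !mem_filter; apply/andP/andP => -[ne].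
    move=> eP; have ed : e != d by apply: contraNneq dP => <-.
    split=> //; apply/mapP; exists e => //; by rewrite swapD.
  move=> /mapP [e' e'P ee']; move: ne; rewrite ee' /swap.
  case: (eqVneq e' c) => [_|e'c _]; first by rewrite eqxx.
  have e'd : e' != d by apply: contraNneq dP => <-.
  by rewrite (negPf e'd).
- move=> u x y t P _ e; rewrite fn_rename; last exact: inj_id.
  by rewrite map_id.
- move=> u x y P _ e; rewrite fn_rename; last exact: inj_id.
  by rewrite map_id.
- by move=> P Q _ IH e; rewrite IH.
- by move=> P Q R _ IH1 _ IH2 e; rewrite IH1.
- by move=> pi P P' _ IH e; rewrite !mem_cat IH.
- by move=> P P' Q Q' _ IH1 _ IH2 e; rewrite !mem_cat IH1 IH2.
- by move=> P P' Q Q' _ IH1 _ IH2 e; rewrite !mem_cat IH1 IH2.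
- by move=> P P' Q Q' _ IH1 _ IH2 e; rewrite !mem_cat IH1 IH2.
- by move=> c P P' _ IH e; rewrite !mem_filter IH.
Qed.

Lemma fv_swap x y P : y \notin fv P ->
  [seq z <- fv P | Some x != Some z] =i
  [seq z <- fv (swap_vars x y P) | Some y != Some z].
Proof.
move=> yP z; rewrite !mem_filter fv_rename; last exact: swap_inj.
rewrite !(inj_eq (@Some_inj _)); apply/andP/andP => -[ne].
  move=> zP; have zy : z != y by apply: contraNneq yP => <-.
  split; first by rewrite eq_sym.
  by apply/mapP; exists z => //; rewrite swapD // eq_sym.
move=> /mapP [z' z'P ez']; move: ne; rewrite ez' /swap.
case: (eqVneq z' x) => [_|z'x _]; first by rewrite eqxx.
have z'y : z' != y by apply: contraNneq yP => <-.
by rewrite (negPf z'y) eq_sym.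
Qed.

Lemma alpha_fv P Q : alpha P Q -> fv P =i fv Q.
Proof.
elim=> {P Q} //=.
- by move=> c d P _ e; rewrite fv_rename // map_id.
- by move=> u x y t P yP e; rewrite !mem_cat (@fv_swap x y P yP).
- by move=> u x y P yP e; rewrite !mem_cat (@fv_swap x y P yP).
- by move=> P Q _ IH e; rewrite IH.
- by move=> P Q R _ IH1 _ IH2 e; rewrite IH1.
- by move=> pi P P' _ IH e; rewrite !mem_cat !mem_filter IH.
- by move=> P P' Q Q' _ IH1 _ IH2 e; rewrite !mem_cat IH1 IH2.
- by move=> P P' Q Q' _ IH1 _ IH2 e; rewrite !mem_cat IH1 IH2.
- by move=> P P' Q Q' _ IH1 _ IH2 e; rewrite !mem_cat IH1 IH2.
Qed.

Lemma alpha_closed P Q : alpha P Q -> closed_proc P -> closed_proc Q.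
Proof.
move=> aPQ; rewrite /closed_proc => fP; have := alpha_fv aPQ; rewrite fP.
by case: (fv Q) => // x s /(_ x); rewrite inE eqxx.
Qed.

Definition head_chan P : option chan := if P is PPre pi _ then Some (subj pi) else None.

Lemma alpha_head P Q : alpha P Q -> head_chan P = head_chan Q.
Proof. by elim=> {P Q} //= P Q R _ -> _ ->. Qed.

Lemma ready_rename f g P c : injective f -> ready P c -> ready (rename f g P) (f c).
Proof.
move=> fI; elim=> {P c}.
- by move=> pi P c e; apply: RD_pre; case: pi e => //= [u x t|u e|u x|u v] ->.
- by move=> P c cP; apply: RD_notfree; rewrite fn_rename // mem_map.
- by move=> P Q c _ r1 _ r2; apply: RD_ext.
- by move=> P Q c _ r1 _ r2; apply: RD_par.
- by move=> P c d _ r1 cd; apply: RD_nu => // /fI.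
Qed.

(** If [c] is not free, [RD_notfree] applies on both sides. Otherwise a renamed restriction involves
    two names different from [c], so the swap fixes [c]; and renaming an input variable keeps the
    subject. *)
Lemma alpha_ready P Q c : alpha P Q -> ready P c <-> ready Q c.
Proof.
move=> aPQ; elim: aPQ c => {P Q}.
- move=> e d P dP c; have aPQ := A_nu e dP.
  have cD : c \in fn P -> c != d by move=> cP; apply: contraNneq dP => <-.
  case: (boolP (c \in fn (PNu e P))) => cP; last first.
    by split=> _; apply: RD_notfree => //; rewrite -(alpha_fn aPQ).
  have: c \in fn P by move: cP => /=; rewrite mem_filter => /andP [].
  move=> /cD cd; have ce : c != e by move: cP; rewrite /= mem_filter => /andP [].
  split=> rc; inversion rc as [|? ? cP'| | |? ? ? rc']; subst;
    try by rewrite -?(alpha_fn aPQ) ?cP in cP'.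
    by apply: RD_nu; [rewrite -(swapD ce cd); apply: ready_rename (@swap_inj _ _) _|apply/eqP].
  apply: RD_nu; last exact/eqP.
  have := ready_rename id (@swap_inj e d) rc'.
  rewrite rename_comp (@eq_rename _ _ id id) ?rename_id ?swapD //.
  by move=> x /=; rewrite swap_inv.
- move=> u x y t P yP c; have aPQ := A_vin u x t yP.
  by split=> rc; inversion rc as [| ? ? cP' | | |]; subst;
    by [apply: RD_pre | apply: RD_notfree; rewrite ?(alpha_fn aPQ) // -(alpha_fn aPQ)].
- move=> u x y P yP c; have aPQ := A_cin u x yP.
  by split=> rc; inversion rc as [| ? ? cP' | | |]; subst;
    by [apply: RD_pre | apply: RD_notfree; rewrite ?(alpha_fn aPQ) // -(alpha_fn aPQ)].
- by [].
- by move=> P Q _ IH c; split=> /IH.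
- by move=> P Q R _ IH1 _ IH2 c; split=> [/IH1/IH2|/IH2/IH1].
- move=> pi P P' /(A_pre pi) aPQ _ c.
  by split=> rc; inversion rc as [| ? ? cP' | | |]; subst;
    by [apply: RD_pre | apply: RD_notfree; rewrite ?(alpha_fn aPQ) // -(alpha_fn aPQ)].
- move=> P P' /A_bang aPQ _ c.
  by split=> rc; inversion rc as [| ? ? cP' | | |]; subst;
    apply: RD_notfree; rewrite ?(alpha_fn aPQ) // -(alpha_fn aPQ).
- move=> P P' Q Q' a1 IH1 a2 IH2 c; have aPQ := A_ext a1 a2.
  by split=> rc; inversion rc as [| ? ? cP' | | |]; subst;
    by [apply: RD_ext; [apply/IH1|apply/IH2]
       | apply: RD_notfree; rewrite ?(alpha_fn aPQ) // -(alpha_fn aPQ)].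
- move=> P P' Q Q' a1 IH1 a2 IH2 c; have aPQ := A_int a1 a2.
  by split=> rc; inversion rc as [| ? ? cP' | | |]; subst;
    apply: RD_notfree; rewrite ?(alpha_fn aPQ) // -(alpha_fn aPQ).
- move=> P P' Q Q' a1 IH1 a2 IH2 c; have aPQ := A_par a1 a2.
  by split=> rc; inversion rc as [| ? ? cP' | | |]; subst;
    by [apply: RD_par; [apply/IH1|apply/IH2]
       | apply: RD_notfree; rewrite ?(alpha_fn aPQ) // -(alpha_fn aPQ)].
- move=> d P P' a1 IH1 c; have aPQ := A_nucongr d a1.
  by split=> rc; inversion rc as [| ? ? cP' | | |]; subst;
    by [apply: RD_nu => //; apply/IH1
       | apply: RD_notfree; rewrite ?(alpha_fn aPQ) // -(alpha_fn aPQ)].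
Qed.

(** * Invariance of transitions under injective renaming, and fresh binders *)

Lemma alpha_rename f P Q : injective f ->
  alpha P Q -> alpha (rename f id P) (rename f id Q).
Proof.
move=> fI; elim=> {P Q} /=.
- move=> c d P dP.
  have -> : rename f id (swap_names c d P) = swap_names (f c) (f d) (rename f id P).
    rewrite /swap_names !rename_comp; apply: eq_rename => // e /=.
    exact: swap_morph.
  by apply: A_nu; rewrite fn_rename // mem_map.
- move=> u x y t P yP.
  have -> : rename f id (swap_vars x y P) = swap_vars x y (rename f id P).
    by rewrite /swap_vars !rename_comp; apply: eq_rename.
  by apply: A_vin; rewrite fv_rename // map_id.
- move=> u x y P yP.
  have -> : rename f id (swap_vars x y P) = swap_vars x y (rename f id P).
    by rewrite /swap_vars !rename_comp; apply: eq_rename.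
  by apply: A_cin; rewrite fv_rename // map_id.
- by move=> P; apply: A_refl.
- by move=> P Q _; apply: A_sym.
- by move=> P Q R _ h1 _; apply: A_trans.
- by move=> pi P P' _; apply: A_pre.
- by move=> P P' _; apply: A_bang.
- by move=> P P' Q Q' _ h1 _; apply: A_ext.
- by move=> P P' Q Q' _ h1 _; apply: A_int.
- by move=> P P' Q Q' _ h1 _; apply: A_par.
- by move=> c P P' _; apply: A_nucongr.
Qed.

Definition msg_rename f (m : msg S) : msg S :=
  match m with MVal v => MVal v | MName d => MName (f d) end.

Definition label_rename f (l : label S) : label S :=
  match l with
  | Tau => Tau
  | In c m => In (f c) (msg_rename f m)
  | Out c m => Out (f c) (msg_rename f m)
  | BOut c d => BOut (f c) (f d)
  end.

Lemma label_fn_rename f (l : label S) : label_fn (label_rename f l) = map f (label_fn l).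
Proof. by case: l => // c []. Qed.

Lemma label_bn_rename f (l : label S) : label_bn (label_rename f l) = map f (label_bn l).
Proof. by case: l. Qed.

Lemma subst_rename f m x P :
  rename f id (subst m x P) = subst (msg_rename f m) x (rename f id P).
Proof.
have ec u : chan_map f id (chan_subst m x u) =
    chan_subst (msg_rename f m) x (chan_map f id u).
  by case: m u => [v|d] [c|y] //=; case: eqP.
elim: P => //= [[u y t|u e|u y|u v] P IH|P ->|P -> Q ->|P -> Q ->|P -> Q ->|c P ->] //=.
- by rewrite ec; case: ifP => // _; rewrite IH.
- rewrite ec IH; congr (PPre (VOut _ _) _).
  by rewrite !esubst_id; case: m {IH ec}.
- by rewrite ec; case: ifP => // _; rewrite IH.
- by rewrite !ec IH.
Qed.

(** Bound names are renamed along with free ones, so injectivity preserves every freshness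
    condition. Used with a swap, it replaces the binder of a restriction by a fresh name. *)
Lemma step_rename f P l Q : injective f ->
  step P l Q -> step (rename f id P) (label_rename f l) (rename f id Q).
Proof.
move=> fI; elim=> {P l Q} /=; try by [econstructor].
- move=> P P1 l Q1 Q aP _ IH aQ.
  by apply: R_alpha IH _; apply: alpha_rename.
- move=> c x d P dP; rewrite subst_rename; apply: R_cin.
  by rewrite restricted_rename mem_map.
- by move=> c x t v P vt; rewrite subst_rename; apply: R_vin.
- by move=> c e v P ev; apply: R_vout; rewrite esubst_id.
- by move=> P Q l P' lT _ IH; apply: R_extl => //; case: l lT {IH}.
- by move=> P Q l P' lT _ IH; apply: R_extr => //; case: l lT {IH}.
- by move=> P Q c m P' Q' _ h1 _ h2; apply: R_coml h1 h2.
- by move=> P Q c m P' Q' _ h1 _ h2; apply: R_comr h1 h2.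
- move=> P Q c d P' Q' _ h1 _ h2 dQ; apply: R_closel h1 h2 _.
  by rewrite fn_rename // mem_map.
- move=> P Q c d P' Q' _ h1 _ h2 dQ; apply: R_closer h1 h2 _.
  by rewrite fn_rename // mem_map.
- move=> P Q l P' _ IH h; apply: R_parl => // d.
  rewrite label_bn_rename => /mapP [e /h eQ ->].
  by rewrite fn_rename // mem_map.
- move=> P Q l P' _ IH h; apply: R_parr => // d.
  rewrite label_bn_rename => /mapP [e /h eQ ->].
  by rewrite fn_rename // mem_map.
- move=> d P l P' _ IH h; apply: R_nu => //.
  by rewrite label_fn_rename label_bn_rename -map_cat mem_map.
- by move=> c d P P' _ IH cd; apply: R_open => // /fI.
Qed.

Lemma exists_fresh (X : seq name) : exists d, d \notin X.
Proof.
exists (\max_(x <- X) x).+1; apply/negP => dX.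
by have := @leq_bigmax_seq _ X xpredT id _ dX isT; rewrite ltnn.
Qed.

(** Makes [R_cin] applicable to any received name. The induction covers all injective renamings of
    [P], so that the swap performed at a restriction is absorbed by the renaming of its body. *)
Lemma alpha_unrestricted d P : exists2 P', alpha P P' & d \notin restricted P'.
Proof.
suff H f : injective f -> exists2 P', alpha (rename f id P) P' & d \notin restricted P'.
  by rewrite -[P]rename_id; apply: H; apply: inj_id.
elim: P f => /= [|pi P IH|P IH|P IHP Q IHQ|P IHP Q IHQ|P IHP Q IHQ|c P IH] f fI.
- by exists PNil => //; apply: A_refl.
- have [P' aP dP'] := IH f fI; eexists; first exact: A_pre aP.
  by [].
- by have [P' aP dP'] := IH f fI; exists (PBang P'); first exact: A_bang.
- have [[P' aP dP'] [Q' aQ dQ']] := (IHP f fI, IHQ f fI); exists (PExt P' Q').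
    exact: A_ext.
  by rewrite /= mem_cat negb_or dP'.
- have [[P' aP dP'] [Q' aQ dQ']] := (IHP f fI, IHQ f fI); exists (PInt P' Q').
    exact: A_int.
  by rewrite /= mem_cat negb_or dP'.
- have [[P' aP dP'] [Q' aQ dQ']] := (IHP f fI, IHQ f fI); exists (PPar P' Q').
    exact: A_par.
  by rewrite /= mem_cat negb_or dP'.
- have [e] := exists_fresh (d :: fn (rename f id P)).
  rewrite inE negb_or => /andP [ed eP].
  have [|P' aP dP'] := IH (swap (f c) e \o f); first exact: inj_comp (@swap_inj _ _) fI.
  exists (PNu e P'); last by rewrite /= inE negb_or eq_sym ed.
  apply: A_trans (A_nu _ eP) _; apply: A_nucongr.
  by rewrite /swap_names rename_comp.
Qed.

End Processes.

(** * Actions of a process on a channel *)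

Section Offers.
Variables (S : values) (L : language S).
Implicit Types (P Q : proc L).

(* A delegated name may be extruded; [X] are the names that the bound name of
   the label has to avoid in the context. *)
Definition offers P (c : name) (m : slabel S) : Prop :=
  match m with
  | Tick => c \notin fn P
  | SLInV v => exists Q, step P (In c (MVal v)) Q
  | SLOutV v => exists Q, step P (Out c (MVal v)) Q
  | SLInS _ => forall d, exists Q, step P (In c (MName d)) Q
  | SLOutS _ => forall X : seq name,
      (exists d Q, step P (Out c (MName d)) Q) \/
      (exists d Q, d \notin X /\ step P (BOut c d) Q)
  end.

Lemma alpha_offers P Q c m : alpha P Q -> offers P c m -> offers Q c m.
Proof.
move=> aPQ; have {}step_alpha l P' : step P l P' -> step Q l P'.
  by move=> st; apply: R_alpha (A_sym aPQ) st (A_refl _).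
case: m => [|v|v|r|r] /=.
- by rewrite (alpha_fn aPQ).
- by move=> [P' st]; exists P'; apply: step_alpha.
- by move=> [P' st]; exists P'; apply: step_alpha.
- by move=> st d; have [P' {}st] := st d; exists P'; apply: step_alpha.
- move=> st X; case: (st X) => [[d [P' {}st]]|[d [P' [dX {}st]]]].
    by left; exists d, P'; apply: step_alpha.
  by right; exists d, P'; split=> //; apply: step_alpha.
Qed.

Lemma offers_extl P Q c m : m <> Tick -> offers P c m -> offers (PExt P Q) c m.
Proof.
case: m => [|v|v|r|r] //= _.
- by move=> [P' st]; exists P'; apply: R_extl.
- by move=> [P' st]; exists P'; apply: R_extl.
- by move=> st d; have [P' {}st] := st d; exists P'; apply: R_extl.
- move=> st X; case: (st X) => [[d [P' {}st]]|[d [P' [dX {}st]]]].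
    by left; exists d, P'; apply: R_extl.
  by right; exists d, P'; split=> //; apply: R_extl.
Qed.

Lemma offers_extr P Q c m : m <> Tick -> offers Q c m -> offers (PExt P Q) c m.
Proof.
case: m => [|v|v|r|r] //= _.
- by move=> [P' st]; exists P'; apply: R_extr.
- by move=> [P' st]; exists P'; apply: R_extr.
- by move=> st d; have [P' {}st] := st d; exists P'; apply: R_extr.
- move=> st X; case: (st X) => [[d [P' {}st]]|[d [P' [dX {}st]]]].
    by left; exists d, P'; apply: R_extr.
  by right; exists d, P'; split=> //; apply: R_extr.
Qed.

Lemma offers_parl P Q c m : m <> Tick -> offers P c m -> offers (PPar P Q) c m.
Proof.
case: m => [|v|v|r|r] //= _.
- by move=> [P' st]; exists (PPar P' Q); apply: R_parl.
- by move=> [P' st]; exists (PPar P' Q); apply: R_parl.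
- by move=> st d; have [P' {}st] := st d; exists (PPar P' Q); apply: R_parl.
(* Avoiding [fn Q] as well gives the side condition of [R_parl] on the extruded name. *)
- move=> st X; case: (st (fn Q ++ X)) => [[d [P' {}st]]|[d [P' [dX {}st]]]].
    by left; exists d, (PPar P' Q); apply: R_parl.
  move: dX; rewrite mem_cat negb_or => /andP [dQ dX].
  right; exists d, (PPar P' Q); split=> //; apply: R_parl => // e.
  by rewrite inE => /eqP ->.
Qed.

Lemma offers_parr P Q c m : m <> Tick -> offers Q c m -> offers (PPar P Q) c m.
Proof.
case: m => [|v|v|r|r] //= _.
- by move=> [Q' st]; exists (PPar P Q'); apply: R_parr.
- by move=> [Q' st]; exists (PPar P Q'); apply: R_parr.
- by move=> st d; have [Q' {}st] := st d; exists (PPar P Q'); apply: R_parr.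
- move=> st X; case: (st (fn P ++ X)) => [[d [Q' {}st]]|[d [Q' [dX {}st]]]].
    by left; exists d, (PPar P Q'); apply: R_parr.
  move: dX; rewrite mem_cat negb_or => /andP [dP dX].
  right; exists d, (PPar P Q'); split=> //; apply: R_parr => // e.
  by rewrite inE => /eqP ->.
Qed.

(** This is where bound outputs arise: delegating the restricted name itself opens its scope. In
    both channel cases the binder [d] is first exchanged for a fresh [e]. *)
Lemma offers_nu P c d m : c <> d -> offers P c m -> offers (PNu d P) c m.
Proof.
move=> /eqP cd; case: m => [|v|v|r|r] /=.
- by rewrite mem_filter cd.
- by move=> [P' st]; exists (PNu d P'); apply: R_nu => //=; rewrite !inE eq_sym.
- by move=> [P' st]; exists (PNu d P'); apply: R_nu => //=; rewrite !inE eq_sym.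
(* The name [f] to be received may be [d] itself. [P] is made to receive [swap d e f], which the
   renaming turns back into [f]. *)
- move=> st f; have [e] := exists_fresh [:: c, f & fn P].
  rewrite !inE !negb_or => /and3P [ec ef eP].
  have [P' {}st] := st (swap d e f); exists (PNu e (rename (swap d e) id P')).
  apply: (R_alpha (A_nu d eP) _ (A_refl _)).
  apply: R_nu; last by rewrite /= !inE negb_or ec.
  have := step_rename (@swap_inj d e) st.
  by rewrite /= swap_inv swapD // eq_sym.
- move=> st X; have [e] := exists_fresh (c :: X ++ fn P).
  rewrite !inE mem_cat !negb_or => /and3P [ec eX eP].
  have cE : swap d e c = c by rewrite swapD // eq_sym.
  have stE l P' := step_rename (@swap_inj d e) (P := P) (l := l) (Q := P').
  have aE := A_nu d eP.
  (* An extruded name has to avoid [X] after the swap, hence the image of [X]; excluding [d] keeps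
     it different from the new binder [e]. *)
  case: (st (d :: map (swap d e) X)) => [[f [P' /stE]]|[f [P' [fX /stE]]]];
    rewrite /= cE => {}st.
    case: (eqVneq (swap d e f) e) => [fe|fe].
      right; exists e, (rename (swap d e) id P'); split=> //.
      apply: (R_alpha aE _ (A_refl _)); apply: R_open; last by apply/eqP; rewrite eq_sym.
      by rewrite -{2}fe.
    left; exists (swap d e f), (PNu e (rename (swap d e) id P')).
    apply: (R_alpha aE _ (A_refl _)); apply: R_nu => //=.
    by rewrite !inE negb_or ec eq_sym.
  move: fX; rewrite inE negb_or => /andP [fd fX].
  right; exists (swap d e f), (PNu e (rename (swap d e) id P')); split.
    by apply: contra fX => fX; apply/mapP; exists (swap d e f) => //; rewrite swap_inv.
  apply: (R_alpha aE _ (A_refl _)); apply: R_nu => //=.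
  rewrite !inE negb_or ec /=; apply: contra fd => /eqP ef.
  have : f = swap d e e by rewrite {2}ef swap_inv.
  by rewrite /swap eqxx; case: (eqVneq e d) => [->|_] ->.
Qed.

Lemma offers_valueE P Q c v : offers P c (SLOutV v) -> offers Q c (SLInV v) ->
  (exists R, step (PPar P Q) Tau R) /\ (exists R, step (PPar Q P) Tau R).
Proof.
move=> [P' sP] [Q' sQ]; split.
- by exists (PPar P' Q'); apply: R_coml sP sQ.
- by exists (PPar Q' P'); apply: R_comr sQ sP.
Qed.

(** Nothing relates [r] and [r']: processes exchange names without comparing types, so a failing
    delegation between types is answered just as a successful one. Taking [fn Q] as the names to
    avoid meets the condition of the closing rules. *)
Lemma offers_chanE P Q c r r' : offers P c (SLOutS r) -> offers Q c (SLInS r') ->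
  (exists R, step (PPar P Q) Tau R) /\ (exists R, step (PPar Q P) Tau R).
Proof.
move=> sP sQ; case: (sP (fn Q)) => [[d [P' {}sP]]|[d [P' [dQ {}sP]]]];
  have [Q' {}sQ] := sQ d; split.
- by exists (PPar P' Q'); apply: R_coml sP sQ.
- by exists (PPar Q' P'); apply: R_comr sQ sP.
- by exists (PNu d (PPar P' Q')); apply: R_closel sP sQ dQ.
- by exists (PNu d (PPar Q' P')); apply: R_closer sQ sP dQ.
Qed.

End Offers.

(** * Typed processes *)

Section Typing.
Variables (S : values) (L : language S) (le : stree S -> stree S -> Prop).
Hypothesis Hle : is_preceq le.
Implicit Types (P Q : proc L) (D E : chan -> option (stree S)) (a b t : stree S).

Lemma upd_same D u a : upd D u a u = Some a.
Proof. by rewrite /upd eqxx. Qed.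

Lemma upd_other D u w a : w != u -> upd D u a w = D w.
Proof. by rewrite /upd => /negPf ->. Qed.

Lemma session_env_upd D u a : D u = None ->
  session_env (upd D u a) <-> session_env D /\ session_type a.
Proof.
move=> Du; split=> [sD|[sD sa] w b].
  split; last by apply: (sD u); rewrite upd_same.
  move=> w b Dw; apply: (sD w); rewrite upd_other //.
  by apply/eqP => wu; rewrite wu Du in Dw.
by rewrite /upd; case: eqP => [_ [<-]|_ /sD].
Qed.

Lemma iter_ext_nonempty (l : list (action L * proc L * stree S)) P a :
  iter_ext l P a -> exists pi Q b, List.In (pi, Q, b) l.
Proof.
elim=> [pi {}P {}a|l1 l2 {}P Q {}a b _ [pi [Q' [b' h]]] _ _].
  by exists pi, P, a; left.
by exists pi, Q', b'; apply: List.in_or_app; left.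
Qed.

Lemma iter_ext_fn (l : list (action L * proc L * stree S)) P a c :
  iter_ext l P a ->
  (c \in fn P <-> exists pi Q b, List.In (pi, Q, b) l /\ c \in fn (PPre pi Q)).
Proof.
elim=> [pi {}P {}a|l1 l2 {}P Q {}a b _ IH1 _ IH2].
  split=> [cP|[pi' [Q [b [[[<- <- _] //|[]]]]]]].
  by exists pi, P, a; split=> //; left.
rewrite /= mem_cat; split.
  case/orP => [/IH1|/IH2] [pi [R [d [h cR]]]]; exists pi, R, d; split=> //;
    apply: List.in_or_app; by [left|right].
move=> [pi [R [d [/(@List.in_app_or _ _ _ _) h cR]]]]; apply/orP.
by case: h => h; [left; apply/IH1|right; apply/IH2]; exists pi, R, d.
Qed.

(** Supplies the well-formedness asked for by [sqsub_ext_sub] and [par_sub_par]. [T_sub] and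
    [T_outputS] introduce types absent from their typing premises, and have it as a premise of their
    own. *)
Lemma typed_session_env G P D : typed le G P D -> session_env D.
Proof.
elim=> {G P D} //.
- by move=> G P D u _ sD Du; apply/session_env_upd.
- move=> G P D u a b Du _ /(session_env_upd _ Du) [sD sb] sa _.
  by apply/session_env_upd.
- by move=> G P D c a Dc _ /(session_env_upd _ Dc) [].
- move=> G P D u x t a Du _ _ _ /(session_env_upd _ Du) [sD sa].
  by apply/session_env_upd => //; split=> //; apply: session_inV.
- move=> G P u x r _ _ /session_env_upd-/(_ erefl) [_ sr].
  by apply/session_env_upd; split=> //; apply: session_inS.
- move=> G P D u e t a Du _ _ /(session_env_upd _ Du) [sD sa].
  by apply/session_env_upd => //; split=> //; apply: session_outV.
- move=> G P D u v r a b Du Dv uv sr _.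
  have vu : v != u by apply/eqP => /esym.
  have Dv' c : upd D u c v = None by rewrite upd_other.
  move=> /(session_env_upd _ (Dv' _)) [/(session_env_upd _ Du) [sD sa] sb].
  by apply/session_env_upd => //; split; auto; apply/session_env_upd; auto.
- move=> G D u l P a Du _ _ IH lP.
  apply/session_env_upd => //; split.
    have [pi [Q [b /IH]]] := iter_ext_nonempty lP.
    by move=> /(session_env_upd _ Du) [].
  elim: lP IH {Du} => [pi {}P {}a IH|l1 l2 {}P Q {}a b _ IH1 _ IH2 IH].
    by apply: (IH pi P a _ u); [left|rewrite upd_same].
  apply: session_ext; [apply: IH1|apply: IH2] => pi R d h;
    apply: (IH pi R d); apply: List.in_or_app; by [left|right].
- move=> G P Q D E _ _ sD _ sE u a; rewrite /par_env.
  case Du: (D u) => [b|//]; case Eu: (E u) => [d|//] [<-].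
  by apply: session_par; [apply: sD Du|apply: sE Eu].
Qed.

(** Excludes that weakening introduces the type of a free name. *)
Lemma typed_fn G P D c : typed le G P D -> c \in fn P -> D (Name c) <> None.
Proof.
have subjP u (X : seq name) : c \in chan_fn u ++ X -> u = Name c \/ c \in X.
  by case: u => /= [d|x]; [rewrite inE => /orP [/eqP ->|]; [left|right]|right].
elim=> {G P D} //.
- by move=> G P P' D aP _ IH; rewrite -(alpha_fn aP).
- by move=> G P D u _ IH Du cP; rewrite /upd; case: ifP => // _; apply: IH.
- by move=> G P D u a b Du _ IH _ _ cP; have := IH cP; rewrite /upd; case: ifP.
- move=> G P D d a Dd _ IH; rewrite /= mem_filter => /andP [cd cP].
  by have := IH cP; rewrite upd_other.
- move=> G P D u x t a Du _ _ _ IH /subjP [->|/IH]; first by rewrite upd_same.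
  by rewrite /upd; case: ifP.
- move=> G P u x r _ _ IH /subjP [->|/IH //]; first by rewrite upd_same.
- move=> G P D u e t a Du _ _ IH /subjP [->|/IH]; first by rewrite upd_same.
  by rewrite /upd; case: ifP.
- move=> G P D u v r a b Du Dv uv sr _ IH; rewrite /= -catA.
  move=> /subjP [->|/subjP [->|/IH]]; rewrite /upd ?eqxx //; first by case: ifP.
  by case: ifP => // _; case: ifP.
- move=> G D u l P a Du _ _ IH lP /(iter_ext_fn _ lP) [pi [Q [b [h cQ]]]].
  by have := IH _ _ _ h cQ; rewrite /upd; case: ifP.
- by move=> G P Q D _ IH1 _ IH2; rewrite /= mem_cat => /orP [/IH1|/IH2].
- move=> G P Q D E DE _ IH1 _ IH2; have := DE (Name c); rewrite /par_env /=.
  rewrite mem_cat => -[de ed] /orP [/IH1|/IH2]; case: (D _) de ed => [?|] h1 h2 //;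
    case: (E _) h1 h2 => [?|] h1 h2 // _; by [have := h2 erefl|have := h1 erefl].
Qed.

(* A process on which [c] is not free owes its type for [c] to weakening alone. *)
Lemma typed_notfree G P D c a : typed le G P D -> c \notin fn P ->
  D (Name c) = Some a ->
  exists t, [/\ session_type t, par_sub le a t, (forall t', ~ sint le t t') &
    forall m t', strans t m t' -> m = Tick].
Proof.
move=> typP; elim: typP a => {G P D} //.
- by move=> G P P' D aP _ IH a; rewrite -(alpha_fn aP); apply: IH.
- move=> G P D u _ IH Du a cP; rewrite /upd; case: eqP => [_ [<-]|_]; last exact: IH.
  by exists SOne; split=> // [t'|m t'] st; inv st.
- move=> G P D u a b Du typP IH sa ab d cP; have sE := typed_session_env typP.
  have [sD sb] := (session_env_upd _ Du).1 sE.
  have := IH ^~ cP; rewrite /upd; case: eqP => [_ /(_ _ erefl) [t [st bt h1 h2]] [<-]|_];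
    last exact.
  exists t; split=> //; apply: par_sub_trans bt.
  by apply: ext_sub_par_sub; apply: sqsub_ext_sub.
- move=> G P D d b Dd _ IH a; rewrite /= mem_filter negb_and negbK => cP Dc.
  have cd : Name c != Name d :> chan by apply/eqP => cd; rewrite cd Dd in Dc.
  by apply: IH; [case/orP: cP cd => // /eqP ->; rewrite eqxx|rewrite upd_other].
- move=> G P D u x t b Du _ _ _ IH a; rewrite /= mem_cat negb_or => /andP [cu cP].
  have uc : Name c != u by apply: contraNneq cu => <- /=; rewrite inE.
  by have := IH a cP; rewrite !upd_other.
- move=> G P u x r _ _ _ a; rewrite /= mem_cat negb_or => /andP [cu _].
  have uc : Name c != u by apply: contraNneq cu => <- /=; rewrite inE.
  by rewrite upd_other.
- move=> G P D u e t b Du _ _ IH a; rewrite /= mem_cat negb_or => /andP [cu cP].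
  have uc : Name c != u by apply: contraNneq cu => <- /=; rewrite inE.
  by have := IH a cP; rewrite !upd_other.
- move=> G P D u v r b d Du Dv uv sr _ IH a.
  rewrite /= !mem_cat !negb_or -andbA => /and3P [cu cv cP].
  have uc : Name c != u by apply: contraNneq cu => <- /=; rewrite inE.
  have vc : Name c != v by apply: contraNneq cv => <- /=; rewrite inE.
  by have := IH a cP; rewrite !upd_other.
- move=> G D u l P b Du lu _ IH lP a cP.
  (* Away from the subject all summands share one environment, so any of them provides the type. *)
  have [pi [Q [d h]]] := iter_ext_nonempty lP.
  have cQ : c \notin fn (PPre pi Q).
    by apply: contra cP => cQ; apply/(iter_ext_fn _ lP); exists pi, Q, d.
  have uc : Name c != u.
    apply: contraNneq cQ => cu; have := lu _ _ _ h; rewrite -cu.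
    by case: (pi) => [w x t|w e|w x|w v] /= ->; rewrite inE eqxx.
  by have := IH _ _ _ h a cQ; rewrite !upd_other.
- by move=> G P Q D _ IH _ _ a; rewrite /= mem_cat negb_or => /andP [cP _]; apply: IH.
- move=> G P Q D E _ typP IHP typQ IHQ a; rewrite /= mem_cat negb_or /par_env.
  move=> /andP [cP cQ]; case Dc: (D _) => [a1|//]; case Ec: (E _) => [a2|//] [<-].
  have [t1 [st1 at1 i1 l1]] := IHP _ cP Dc.
  have [t2 [st2 at2 i2 l2]] := IHQ _ cQ Ec.
  exists (SPar t1 t2); split; first exact: session_par.
  + by apply: par_sub_par => //; apply: (typed_session_env typQ) Ec.
  + move=> t' st; inv st; try by [apply: i1; eauto|apply: i2; eauto];
    match goal with
    | H : strans t1 _ _ |- _ => by have := l1 _ _ H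
    end.
  + by move=> m t' st; inv st => //; eauto.
Qed.

(* Equality, because [!v.k] has an internal transition to itself. *)
Definition matches P c t :=
  (forall t', sint le t t' -> t' = t) /\
  (forall m t', strans t m t' -> offers P c m).

(** The conclusion uses [ext_sub] because the prefix may be a summand. Rules that are not directed
    by the syntax may still end the derivation, and so may [T_ext] with a single summand. *)
Lemma typed_prefix G P D c a : typed le G P D -> head_chan P = Some (Name c) ->
  closed_proc P -> D (Name c) = Some a ->
  exists t, [/\ session_type t, ext_sub le a t, (forall t', ~ strans t Tick t') &
    matches P c t].
Proof.
move=> typP; elim: typP a => {G P D} //.
- move=> G P P' D aP _ IH a; rewrite -(alpha_head aP) => hP cP Dc.
  have [t [st at_ nt [ti to]]] := IH _ hP (alpha_closed (A_sym aP) cP) Dc.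
  by exists t; split=> //; split=> // m t' /to; apply: alpha_offers.
- move=> G P D u typP IH Du a hP cP; rewrite /upd; case: eqP => [uc|_]; last exact: IH.
  case: (typed_fn (c := c) typP); last by rewrite uc.
  by case: (P) hP => // -[w x t|w e|w x|w v] Q [->]; rewrite /= inE eqxx.
- move=> G P D u a b Du typP IH sa ab d hP cP; have sE := typed_session_env typP.
  have [sD sb] := (session_env_upd _ Du).1 sE.
  have := (IH ^~ hP) ^~ cP; rewrite /upd.
  case: eqP => [_ /(_ _ erefl) [t [st bt h1 h2]] [<-]|_]; last exact.
  exists t; split=> //; apply: ext_sub_trans bt; exact: sqsub_ext_sub.
- move=> G P D u x t a Du Gx Dx typP _ b [->] cP; rewrite upd_same => -[<-].
  exists (SInV t a); split.
  + have sE := typed_session_env typP.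
    by have [sD sa] := (session_env_upd _ Du).1 sE; apply: session_inV.
  + by move=> r sr.
  + by move=> t' st; inv st.
  + split=> [t' st|m t' st]; inv st.
    by eexists; apply: R_vin.
- move=> G P u x r Gx typP _ a [->] cP; rewrite upd_same => -[<-].
  exists (SInS r SOne); split.
  + have sE := typed_session_env typP.
    by apply: session_inS => //; apply: (sE (Var x)); rewrite upd_same.
  + by move=> r' sr.
  + by move=> t' st; inv st.
  + split=> [t' st|m t' st]; inv st => d.
    have [P' aP dP'] := alpha_unrestricted d P.
    by eexists; apply: R_alpha (A_pre _ aP) (R_cin _ _ dP') (A_refl _).
- move=> G P D u e t a Du te typP _ b [->] cP; rewrite upd_same => -[<-].
  have ce : efv e = [::].
    by move: cP; rewrite /closed_proc /=; case: (efv e).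
  (* The type commits to the value [v] that the process will actually send; closedness of the
     process guarantees that there is one. *)
  have [v ev] := etyp_eval ce te; have vt := etyp_sound ce te ev.
  exists (SOutV (TSing v) a); split.
  + have sE := typed_session_env typP.
    by have [sD sa] := (session_env_upd _ Du).1 sE; apply: session_outV.
  + by apply: ext_sub_sint; constructor.
  + by move=> t' st; inv st.
  + split=> [t' st|m t' st]; inv st; first by rewrite /= in H2; subst.
    by eexists; apply: R_vout.
- move=> G P D u v r a b Du Dv uv sr typP _ d [uc] cP.
  have uv' : u != v by apply/eqP.
  have vu : v != u by rewrite eq_sym.
  rewrite -{1}uc upd_other // upd_same => -[<-].
  have [e ve] : exists e, v = Name e.
    by move: cP; rewrite /closed_proc uc /=; case: (v) => [e|//]; exists e.
  subst u v; exists (SOutS r a); split.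
  + have sE := typed_session_env typP; apply: session_outS => //.
    by apply: (sE (Name c)); rewrite upd_other // upd_same.
  + by move=> r' sr'.
  + by move=> t' st; inv st.
  + split=> [t' st|m t' st]; inv st => X; left.
    by eexists; eexists; apply: R_cout.
- move=> G D u l P a Du lu typl IH lP b hP cP.
  inversion lP; subst; last by [].
  by apply: (IH pi P0 a) => //; left.
Qed.

(** Absence of ticks is part of the invariant: a sum ticks as soon as one summand does, whereas
    [offers] at [Tick] says that [c] is free in none of them. *)
Lemma iter_ext_matches (l : list (action L * proc L * stree S)) P a c :
  iter_ext l P a -> closed_proc P ->
  (forall pi Q b, List.In (pi, Q, b) l -> session_type b) ->
  (forall pi Q b, List.In (pi, Q, b) l -> closed_proc (PPre pi Q) ->
    exists t, [/\ session_type t, ext_sub le b t, (forall t', ~ strans t Tick t') &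
    matches (PPre pi Q) c t]) ->
  session_type a /\
  exists t, [/\ session_type t, ext_sub le a t, (forall t', ~ strans t Tick t') &
    matches P c t].
Proof.
elim=> [pi {}P {}a|l1 l2 {}P Q {}a b _ IH1 _ IH2] cP sl hl.
  by split; [apply: (sl pi P)|apply: hl => //]; left.
have [cP1 cQ] : closed_proc P /\ closed_proc Q.
  by move: cP; rewrite /closed_proc /=; case: (fv P) => // ->.
have [|pi R d h|sa [t1 [st1 at1 nt1 [i1 o1]]]] := IH1 cP1.
  by move=> pi R d h; apply: (sl pi R); apply: List.in_or_app; left.
  by apply: hl; apply: List.in_or_app; left.
have [|pi R d h|sb [t2 [st2 at2 nt2 [i2 o2]]]] := IH2 cQ.
  by move=> pi R d h; apply: (sl pi R); apply: List.in_or_app; right.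
  by apply: hl; apply: List.in_or_app; right.
split; first exact: session_ext.
exists (SExt t1 t2); split; first exact: session_ext.
- exact: ext_sub_ext.
- by move=> t' st; inv st; [apply: nt1 H3|apply: nt2 H3].
- split=> [t' st|m t' st]; inv st.
  + by rewrite (i1 _ H2).
  + by rewrite (i2 _ H2).
  + by apply: offers_extl; [move=> em; subst; apply: nt1 H3|apply: o1 H3].
  + by apply: offers_extr; [move=> em; subst; apply: nt2 H3|apply: o2 H3].
Qed.

(** For a prefix on another subject, readiness can only come from [RD_notfree]. *)
Lemma iter_ext_notready (l : list (action L * proc L * stree S)) P a c u :
  iter_ext l P a -> (forall pi Q b, List.In (pi, Q, b) l -> subj pi = u) ->
  u <> Name c -> ready P c -> c \notin fn P.
Proof.
move=> lP lu uc; elim: lP lu => [pi {}P {}a|l1 l2 {}P Q {}a b _ IH1 _ IH2] lu rP.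
  inversion rP as [? ? ? sc| | | |]; subst => //.
  by case: uc; rewrite -sc (lu pi P a) //; left.
inv rP => //; rewrite /= mem_cat negb_or; apply/andP; split.
- by apply: IH1 => // pi R d h; apply: (lu _ R d); apply: List.in_or_app; left.
- by apply: IH2 => // pi R d h; apply: (lu _ R d); apply: List.in_or_app; right.
Qed.

Definition stuck P := ~ exists Q, step P Tau Q.

(** Here [par_sub] suffices, and it composes by [par_sub_par]: [T_ext] sums prefixed processes only,
    so no choice is formed over the type of a parallel composition. *)
Lemma typed_stuck G P D c a : typed le G P D -> closed_proc P -> ready P c ->
  stuck P -> D (Name c) = Some a ->
  exists t, [/\ session_type t, par_sub le a t & matches P c t].
Proof.
have notfree G' P' D' a' : typed le G' P' D' -> c \notin fn P' ->
    D' (Name c) = Some a' ->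
    exists t, [/\ session_type t, par_sub le a' t & matches P' c t].
  move=> typP cP Dc; have [t [st at_ ti tl]] := typed_notfree typP cP Dc.
  by exists t; split=> //; split=> [t' /ti //|m t' /tl ->].
have prefix G' P' D' a' : typed le G' P' D' -> closed_proc P' -> ready P' c ->
    c \in fn P' -> head_chan P' <> None -> D' (Name c) = Some a' ->
    exists t, [/\ session_type t, par_sub le a' t & matches P' c t].
  move=> typP cP rP fP hP Dc.
  (* As [c] is free, readiness of a prefix must be [RD_pre]: [c] is the subject, not merely a
     delegated name or a name of the continuation. *)
  have hc : head_chan P' = Some (Name c).
    by inversion rP as [? ? ? sc|? ? nf| | |]; subst;
      [rewrite /= sc|rewrite fP in nf| | |].
  have [t [st at_ _ mt]] := typed_prefix typP hc cP Dc.
  by exists t; split=> //; apply: ext_sub_par_sub.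
move=> typP cP rP sP Dc; case: (boolP (c \in fn P)) => [fP|fP];
  last exact: (notfree _ _ _ _ typP).
(* A second copy of the derivation is generalised, because [prefix] and [T_ext] need the typing of
   the whole process beside those of its parts. *)
elim: typP (typP) a cP rP sP Dc fP => {G P D} //.
- move=> G P P' D aP typP IH _ a cP rP sP Dc fP.
  have aP' := A_sym aP.
  have [||| t [st at_ [ti to]]] := IH typP a (alpha_closed aP' cP) _ _ Dc.
  + exact/(alpha_ready _ aP).
  + by move=> [Q PQ]; apply: sP; exists Q; apply: R_alpha aP' PQ (A_refl _).
  + by rewrite (alpha_fn aP).
  by exists t; split=> //; split=> // m t' /to; apply: alpha_offers.
- move=> G P D u typP IH Du _ a cP rP sP; rewrite /upd; case: eqP => [uc|_]; last exact: IH.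
  by move=> _ fP; case: (typed_fn typP fP); rewrite uc.
- move=> G P D u b d Du typP IH sb bd _ a cP rP sP.
  have [sD sd] := (session_env_upd _ Du).1 (typed_session_env typP).
  have := (((IH typP) ^~ cP) ^~ rP) ^~ sP; rewrite /upd.
  case: eqP => [_ H [<-] fP|_]; last exact.
  have [t [st dt mt]] := H _ erefl fP.
  exists t; split=> //; apply: par_sub_trans dt.
  by apply: ext_sub_par_sub; apply: sqsub_ext_sub.
- move=> G P D d b Dd typP IH _ a cP rP sP Dc.
  rewrite /= mem_filter => /andP [/eqP cd fP].
  have rP' : ready P c.
    by inversion rP as [|? ? nf| | |]; subst => //;
      move: nf; rewrite /= mem_filter fP andbT negbK => /eqP.
  have sP' : stuck P by move=> [Q PQ]; apply: sP; exists (PNu d Q); apply: R_nu.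
  have Dc' : upd D (Name d) (SExt SOne b) (Name c) = Some a.
    by rewrite upd_other //; apply/eqP => -[].
  have [t [st at_ [ti to]]] := IH typP a cP rP' sP' Dc' fP.
  by exists t; split=> //; split=> // m t' /to; apply: offers_nu.
- by move=> G P D u x t b *; apply: prefix; eauto.
- by move=> *; apply: prefix; eauto.
- by move=> *; apply: prefix; eauto.
- by move=> *; apply: prefix; eauto.
- move=> G D u l P b Du lu typl IH lP typP a cP rP sP Dc fP.
  case: (eqVneq u (Name c)) => [uc|/eqP uc]; last first.
    by move: fP; rewrite (negPf (iter_ext_notready lP lu uc rP)).
  subst u; move: Dc; rewrite upd_same => -[<-].
  have [||_ [t [st at_ _ mt]]] := iter_ext_matches (c := c) lP cP.
  + move=> pi Q d h; have sE := typed_session_env (typl _ _ _ h).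
    by have [] := (session_env_upd _ Du).1 sE.
  + move=> pi Q d h cQ; apply: typed_prefix (typl _ _ _ h) _ cQ _.
      by rewrite /= (lu _ _ _ h).
    by rewrite upd_same.
  by exists t; split=> //; apply: ext_sub_par_sub.
- by move=> G P Q D _ _ _ _ _ a _ _ []; exists P; apply: R_intl.
- by move=> G P D _ _ _ _ a _ _ []; exists (PPar (PBang P) P); apply: R_bang.
- move=> G P Q D E DE typP IHP typQ IHQ _ a cPQ rPQ sPQ; rewrite /par_env.
  case Dc: (D _) => [a1|//]; case Ec: (E _) => [a2|//] [<-] fPQ.
  have [cP cQ] : closed_proc P /\ closed_proc Q.
    by move: cPQ; rewrite /closed_proc /=; case: (fv P) => // ->.
  have [rP rQ] : ready P c /\ ready Q c.
    by inversion rPQ as [|? ? nf| | |]; subst => //; rewrite fPQ in nf.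
  have sP : stuck P by move=> [R PR]; apply: sPQ; exists (PPar R Q); apply: R_parl.
  have sQ : stuck Q by move=> [R QR]; apply: sPQ; exists (PPar P R); apply: R_parr.
  (* That [c] is free in the composition leaves open in which component; the induction hypothesis
     covers only those where it is. *)
  have [t1 [st1 at1 [i1 o1]]] : exists t, [/\ session_type t, par_sub le a1 t & matches P c t].
    case: (boolP (c \in fn P)) => fP; first exact: IHP.
    exact: (notfree _ _ _ _ typP).
  have [t2 [st2 at2 [i2 o2]]] : exists t, [/\ session_type t, par_sub le a2 t & matches Q c t].
    case: (boolP (c \in fn Q)) => fQ; first exact: IHQ.
    exact: (notfree _ _ _ _ typQ).
  exists (SPar t1 t2); split; first exact: session_par.
    by apply: par_sub_par => //; apply: (typed_session_env typQ) Ec.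
  split=> [t' st|m t' st]; inv st; try solve [case: sPQ; match goal with
    H1 : strans t1 _ _, H2 : strans t2 _ _ |- _ =>
      have h1 := o1 _ _ H1; have h2 := o2 _ _ H2 end; first
    [ by have [] := offers_valueE h1 h2 | by have [] := offers_valueE h2 h1
    | by have [] := offers_chanE h1 h2 | by have [] := offers_chanE h2 h1 ]].
  + by rewrite (i1 _ H2).
  + by rewrite (i2 _ H2).
  + by apply: offers_parl => //; eauto.
  + by apply: offers_parr => //; eauto.
  + by rewrite /= mem_cat negb_or; apply/andP; split;
      [apply: (o1 Tick); eauto|apply: (o2 Tick); eauto].
Qed.

End Typing.

(** * Progress on a channel of complete type *)

Theorem theorem3p2 (S : values) (L : language S)
    (preceq : stree S -> stree S -> Prop) (Hpreceq : is_preceq preceq)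
    (P : proc L) (c : name) (eta : stree S)
    (Gamma : var -> option (vtype S)) (Delta : chan -> option (stree S)) :
  closed_proc P ->
  session_type eta ->
  session_env Delta ->
  Delta (Name c) = None ->
  typed preceq Gamma P (upd Delta (Name c) eta) ->
  complete preceq eta ->
  ready P c ->
  c \notin fn P \/ exists Q : proc L, step P Tau Q.
Proof.
move=> cP _ _ _ typP ceta rP.
case: (classic (exists Q, step P Tau Q)) => [|sP]; [by right|left].
have [t [_ et [ti to]]] :=
  typed_stuck Hpreceq typP cP rP sP (upd_same Delta (Name c) eta).
(* The comparison of [eta] with [t] applies only to compositions with a partner; [SOne] is a partner
   that exchanges no message. *)
have ct := et _ (session_one S) (complete_par_one ceta).
have [b [b' [tb bT]]] := ct _ (rt_refl _ _ _).
(* Every internal move of [SPar t SOne] is a loop, so the promised tick is one of this very type. It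
   contains a tick of [t], which [offers] reads as [c] not being free. *)
have stay x y : clos_refl_trans_1n _ (sint preceq) x y ->
    x = SPar t SOne -> y = SPar t SOne.
  elim=> {x y} [//|x y z xy _ IH] xE; apply: IH.
  by subst x; inv xy; try (by rewrite (ti _ H2)); match goal with
    | H : strans SOne _ _ |- _ => inversion H
    | H : sint _ SOne _ |- _ => inversion H end.
have bE := stay _ _ (clos_rt_rt1n _ _ _ _ tb) erefl.
by subst b; inv bT => //; apply: (to Tick); eauto.
Qed.
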